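(* Let $(X,d,\mu,\mathcal{E},\mathcal{F})$ be a Dirichlet space satisfying the standing assumptions (A1)–(A3), (HK), (BE) stated in the context, and let $0<\delta<1$. Let $1\leq p<\infty$ and $0<\alpha<\frac1p$. Then $$\mathbf{B}^{p,\alpha}(X)=\mathcal{KS}^{\alpha\delta d_W,p}(X)=KS^{\alpha\delta d_W,p}(X).$$ Moreover, $\mathbf{B}^{p,\alpha}(X)$ and $\mathcal{KS}^{\alpha\delta d_W,p}(X)$ have equivalent seminorms, i.e. $\|f\|_{p,\alpha}$ and $\|f\|_{\mathcal{KS}^{\alpha\delta d_W,p}(X)}$ are comparable up to multiplicative constants independent of $f$.
   Context: Setting. $(X,d,\mu)$ is a locally compact metric measure space, $\mu$ a Radon measure supported on $X$, and $(\mathcal{E},\mathcal{F})$ is a Dirichlet form on $L^2(X,\mu)$ with heat semigroup $\{P_t\}_{t>0}$ and generator $L$. Write $B(x,r)=\{y: d(x,y)<r\}$. Korevaar-Schoen spaces. For $\lambda>0$, $1\le p<\infty$: $KS^{\lambda,p}(X)$ is the set of $f\in L^p(X,\mu)$ with $\|f\|_{KS^{\lambda,p}(X)}<\infty$, where $\|f\|_{KS^{\lambda,p}(X)}^p=\limsup_{r\to0^+}\int_X\int_{B(x,r)}\frac{|f(x)-f(y)|^p}{r^{\lambda p}\mu(B(x,r))}d\mu(y)d\mu(x)$; $\mathcal{KS}^{\lambda,p}(X)$ is defined in the same way with the seminorm $\|f\|_{\mathcal{KS}^{\lambda,p}(X)}^p=\sup_{r>0}\int_X\int_{B(x,r)}\frac{|f(x)-f(y)|^p}{r^{\lambda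 p}\mu(B(x,r))}d\mu(y)d\mu(x)$. Standing assumptions. (A1) Every ball $B(x,r)$ has compact closure. (A2) There are $c_1,c_2,d_H>0$ with $c_1r^{d_H}\le\mu(B(x,r))\le c_2r^{d_H}$ for all $x\in X$, $r\ge0$. (A3) $(\mathcal{E},\mathcal{F})$ is regular and strongly local. (HK) $\{P_t\}$ has a continuous heat kernel $p_t(x,y)$ and there are $c_3,c_4,c_5,c_6\in(0,\infty)$, $d_W\in[2,\infty)$ with $c_5t^{-d_H/d_W}\exp(-c_6(d(x,y)^{d_W}/t)^{1/(d_W-1)})\le p_t(x,y)\le c_3t^{-d_H/d_W}\exp(-c_4(d(x,y)^{d_W}/t)^{1/(d_W-1)})$ for $\mu\times\mu$-a.e. $(x,y)$ and every $t>0$. (BE) There is $C>0$ such that $|P_tg(x)-P_tg(y)|\le C\frac{d(x,y)^\kappa}{t^{\kappa/d_W}}\|g\|_{L^\infty(X,\mu)}$ for all $t>0$, $g\in L^\infty(X,\mu)$, $x,y\in X$, where $0<\kappa<d_W$ is defined by $d_W-\kappa=\sup\{\lambda>0: KS^{\lambda,1}(X)\text{ contains non-constant functions}\}$. Subordinated semigroup. For fixed $0<\delta<1$ let $\eta^{(\delta)}_t\ge0$ be the continuous function with $\int_0^\infty\eta^{(\delta)}_t(s)e^{-s\lambda}ds=e^{-t\lambda^\delta}$ for $\lambda>0$. The semigroup with generator given by the fractional Laplacian $(-L)^\delta$ is $P^{(\delta)}_tf=\int_0^\infty\eta^{(\delta)}_t(s)P_sf\,ds$, with heat kernel $p^{(\delta)}_t(x,y)=\int_0^\infty\eta^{(\delta)}_t(s)p_s(x,y)ds$.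 Besov classes. For $p\ge1$, $\alpha\ge0$: $\|f\|_{p,\alpha}=\sup_{t>0}t^{-\alpha}\left(\int_X\int_X|f(x)-f(y)|^pp^{(\delta)}_t(x,y)d\mu(x)d\mu(y)\right)^{1/p}$ and $\mathbf{B}^{p,\alpha}(X)=\{f\in L^p(X,\mu):\|f\|_{p,\alpha}<\infty\}$. *)

(* Defs.v *)
From HB Require Import structures.
From mathcomp Require Import all_boot all_order all_algebra.
From mathcomp Require Import all_classical all_reals all_analysis.

Set Implicit Arguments.
Unset Strict Implicit.
Unset Printing Implicit Defensive.

Import Order.TTheory GRing.Theory Num.Theory.
Import numFieldNormedType.Exports.

Local Open Scope classical_set_scope.
Local Open Scope ring_scope.

(* The compatibility of the two structures (measurable sets = Borel sets) is
   the separate hypothesis [borel_measurable_sets]. *)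
#[short(type="metricMeasurableType")]
HB.structure Definition MetricMeasurable (d : measure_display)
  (R : numDomainType) := { M of Metric R M & Measurable d M }.

Section MetricMeasure.
Context (d : measure_display) (R : realType) (X : metricMeasurableType d R).
Variable mu : {measure set X -> \bar R}.

Definition borel_measurable_sets : Prop :=
  @measurable d X = <<s [set U : set X | open U] >>.

Definition radon_measure : Prop :=
  [/\ forall K : set X, compact K -> (mu K < +oo)%E,
      forall A : set X, measurable A ->
        mu A = ereal_inf [set mu U | U in [set U | open U /\ A `<=` U]]
    & forall U : set X, open U ->
        mu U = ereal_sup [set mu K | K in [set K | compact K /\ K `<=` U]]].

Definition measure_support : set X :=
  [set x | forall U : set X, open_nbhs x U -> (0 < mu U)%E].

Definition relatively_compact_balls : Prop :=
  forall (x : X) (r : R), compact (closure (ball x r)).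

Definition ahlfors_regular (dH : R) : Prop :=
  exists c1 c2 : R, [/\ 0 < c1, 0 < c2 &
    forall (x : X) (r : R), 0 <= r ->
      ((c1 * r `^ dH)%R%:E <= mu (ball x r))%E /\
      (mu (ball x r) <= (c2 * r `^ dH)%R%:E)%E].

(* Elements of L^p are represented by functions; statements about their
   classes are made modulo equality mu-almost everywhere. *)

Definition ae_constant (f : X -> R) : Prop :=
  exists c : R, f = cst c %[ae mu].

Definition korevaar_schoen_energy (lambda p : R) (f : X -> R) (r : R) : \bar R :=
  (\int[mu]_x \int[mu]_(y in ball x r)
     (`|f x - f y| `^ p / (r `^ (lambda * p) * fine (mu (ball x r))))%R%:E)%E.

Definition limsupKS_seminorm (lambda p : R) (f : X -> R) : \bar R :=
  (limf_esup (korevaar_schoen_energy lambda p f) 0^'+%R `^ p^-1)%E.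

Definition supKS_seminorm (lambda p : R) (f : X -> R) : \bar R :=
  (ereal_sup [set korevaar_schoen_energy lambda p f r | r in [set r : R | (0 < r)%R]]
     `^ p^-1)%E.

Definition limsupKS (lambda p : R) : set (X -> R) :=
  [set f | f \in Lfun mu p%:E /\ (limsupKS_seminorm lambda p f < +oo)%E].

Definition supKS (lambda p : R) : set (X -> R) :=
  [set f | f \in Lfun mu p%:E /\ (supKS_seminorm lambda p f < +oo)%E].

Definition L2dot (f g : X -> R) : R := (\int[mu]_x (f x * g x))%R.

Definition L2norm (f : X -> R) : \bar R := ('N[mu]_2%:E[EFin \o f])%E.

Definition form1 (E : (X -> R) -> (X -> R) -> R) (u : X -> R) : R :=
  E u u + L2dot u u.

(* E is only meaningful on F, which is a set of functions closed under
   modification on mu-null sets. *)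
Record dirichlet_form (F : set (X -> R)) (E : (X -> R) -> (X -> R) -> R)
    : Prop := DirichletForm {
  form_dom_L2 : forall u, F u -> u \in Lfun mu 2%:E ;
  form_ae : forall u v, F u -> v \in Lfun mu 2%:E -> u = v %[ae mu] ->
    F v /\ forall w, F w -> E u w = E v w ;
  form_linear : forall (a : R) u v, F u -> F v ->
    F (a *: u + v) /\ forall w, F w -> E (a *: u + v) w = a * E u w + E v w ;
  form_sym : forall u v, F u -> F v -> E u v = E v u ;
  form_ge0 : forall u, F u -> 0 <= E u u ;
  form_dense : forall u, u \in Lfun mu 2%:E -> forall e : R, 0 < e ->
    exists2 v, F v & (L2norm (u - v)%R < e%:E)%E ;
  form_closed : forall u : nat -> X -> R, (forall n, F (u n)) ->
    (forall e : R, 0 < e -> exists N : nat, forall m n : nat,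
       (N <= m)%N -> (N <= n)%N -> form1 E (u m - u n) < e) ->
    exists2 v, F v & form1 E (u n - v) @[n --> \oo] --> (0 : R) ;
  form_markov : forall u, F u ->
    let v := fun x => Num.min (Num.max (u x) 0) 1 in F v /\ E v v <= E u u
}.

Definition continuous_compact_support (u : X -> R) : Prop :=
  continuous u /\ compact (closure [set x | u x != 0]).

Definition regular_form (F : set (X -> R)) (E : (X -> R) -> (X -> R) -> R)
    : Prop :=
  (forall u, F u -> forall e : R, 0 < e ->
     exists v, [/\ F v, continuous_compact_support v & form1 E (u - v) < e]) /\
  (forall u, continuous_compact_support u -> forall e : R, 0 < e ->
     exists v, [/\ F v, continuous_compact_support v &
       forall x, `|u x - v x| < e]).

(* The support of the measure |u| mu. *)
Definition ae_support (u : X -> R) : set X :=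
  [set x | forall U : set X, open_nbhs x U -> ~ (u = cst 0 %[ae mu in U])].

Definition strongly_local (F : set (X -> R)) (E : (X -> R) -> (X -> R) -> R)
    : Prop :=
  forall u v, F u -> F v -> compact (ae_support u) -> compact (ae_support v) ->
    (exists (U : set X) (c : R),
       [/\ open U, ae_support u `<=` U & v = cst c %[ae mu in U]]) ->
    E u v = 0.

(* u is in the domain of the generator of P, with value h. *)
Definition semigroup_generator (P : R -> (X -> R) -> X -> R) (u h : X -> R)
    : Prop :=
  L2norm (t^-1 *: (P t u - u) - h) @[t --> 0^'+] --> (0 : \bar R).

(* u is in the domain of the nonpositive self-adjoint operator L of the form,
   with L u = h. *)
Definition form_generator (F : set (X -> R)) (E : (X -> R) -> (X -> R) -> R)
    (u h : X -> R) : Prop :=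
  F u /\ forall v, F v -> E u v = - L2dot h v.

(* P t is used only for t > 0 and on L^2. *)
Record heat_semigroup (F : set (X -> R)) (E : (X -> R) -> (X -> R) -> R)
    (P : R -> (X -> R) -> X -> R) : Prop := HeatSemigroup {
  semigroup_L2 : forall t u, 0 < t -> u \in Lfun mu 2%:E ->
    P t u \in Lfun mu 2%:E ;
  semigroup_ae : forall t u v, 0 < t -> u \in Lfun mu 2%:E ->
    v \in Lfun mu 2%:E -> u = v %[ae mu] -> P t u = P t v %[ae mu] ;
  semigroup_linear : forall t (a : R) u v, 0 < t -> u \in Lfun mu 2%:E ->
    v \in Lfun mu 2%:E -> P t (a *: u + v) = a *: P t u + P t v %[ae mu] ;
  semigroup_sym : forall t u v, 0 < t -> u \in Lfun mu 2%:E ->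
    v \in Lfun mu 2%:E -> L2dot (P t u) v = L2dot u (P t v) ;
  semigroup_contraction : forall t u, 0 < t -> u \in Lfun mu 2%:E ->
    (L2norm (P t u) <= L2norm u)%E ;
  semigroup_add : forall s t u, 0 < s -> 0 < t -> u \in Lfun mu 2%:E ->
    P (s + t) u = P s (P t u) %[ae mu] ;
  semigroup_continuous : forall u, u \in Lfun mu 2%:E ->
    L2norm (P t u - u) @[t --> 0^'+] --> (0 : \bar R) ;
  semigroup_generatorE : forall u h, u \in Lfun mu 2%:E ->
    h \in Lfun mu 2%:E ->
    semigroup_generator P u h <-> form_generator F E u h
}.

Definition heat_kernel (P : R -> (X -> R) -> X -> R) (k : R -> X -> X -> R)
    : Prop :=
  (forall (t : R) (x y : X), 0 < t ->
     {for (t, x, y), continuous (fun z : R * X * X => k z.1.1 z.1.2 z.2)}) /\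
  (forall (t : R) (u : X -> R), 0 < t -> u \in Lfun mu 2%:E ->
     P t u = (fun x => \int[mu]_y (k t x y * u y))%R %[ae mu]).

Definition sub_gaussian_profile (dH dW c c' t r : R) : R :=
  c * t `^ (- (dH / dW)) * expR (- (c' * (r `^ dW / t) `^ (dW - 1)^-1)).

Definition heat_kernel_bounds (dH dW : R) (k : R -> X -> X -> R) : Prop :=
  exists c3 c4 c5 c6 : R, [/\ 0 < c3, 0 < c4, 0 < c5, 0 < c6 &
    forall t : R, 0 < t -> \forall z \ae (mu \x mu)%E,
      sub_gaussian_profile dH dW c5 c6 t (mdist z.1 z.2) <= k t z.1 z.2 /\
      k t z.1 z.2 <= sub_gaussian_profile dH dW c3 c4 t (mdist z.1 z.2)].

(* P_t on L^oo is the integral operator of the heat kernel, so that P_t g is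
   defined at every point. *)
Definition weak_bakry_emery (dW kappa : R) (k : R -> X -> X -> R) : Prop :=
  exists2 C : R, 0 < C &
    forall (t : R) (g : X -> R) (x y : X), 0 < t -> g \in Lfun mu +oo%E ->
      let Pg z := (\int[mu]_w (k t z w * g w))%R in
      (`|Pg x - Pg y|%R%:E <=
        (C * (mdist x y `^ kappa / t `^ (kappa / dW)))%R%:E *
        'N[mu]_+oo[EFin \o g])%E.

Definition critical_exponent (dW kappa : R) : Prop :=
  (dW - kappa)%:E = ereal_sup [set lambda%:E | lambda in
    [set lambda : R | 0 < lambda /\
       exists2 f, limsupKS lambda 1 f & ~ ae_constant f]].

Definition subordinated_kernel (eta : R -> R -> R) (k : R -> X -> X -> R)
    (t : R) (x y : X) : \bar R :=
  (\int[lebesgue_measure]_(s in `]0%R, +oo[) (eta t s * k s x y)%R%:E)%E.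

Definition besov_seminorm (K : R -> X -> X -> \bar R) (p alpha : R)
    (f : X -> R) : \bar R :=
  ereal_sup [set ((t `^ (- alpha))%R%:E *
      (\int[mu]_y \int[mu]_x ((`|f x - f y| `^ p)%R%:E * K t x y)) `^ p^-1)%E
    | t in [set t : R | 0 < t]].

Definition besov_class (K : R -> X -> X -> \bar R) (p alpha : R)
    : set (X -> R) :=
  [set f | f \in Lfun mu p%:E /\ (besov_seminorm K p alpha f < +oo)%E].

End MetricMeasure.

(* These conditions determine eta t on ]0, +oo[: it is the density of the
   delta-stable subordinator at time t. *)
Definition stable_subordinator_density (R : realType) (delta : R)
    (eta : R -> R -> R) : Prop :=
  forall t : R, 0 < t ->
    [/\ forall s : R, 0 < s -> 0 <= eta t s,
        forall s : R, 0 < s -> {for s, continuous (eta t)}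
      & forall lambda : R, 0 < lambda ->
          (\int[lebesgue_measure]_(s in `]0%R, +oo[)
             (eta t s * expR (- (s * lambda)))%R%:E)%E =
          (expR (- (t * lambda `^ delta)))%R%:E].

(* Main.v *)
From HB Require Import structures.
Require Import Defs.
From mathcomp Require Import all_boot all_order all_algebra.
From mathcomp Require Import all_classical all_reals all_analysis.
From mathcomp Require Import finmap measurable_realfun.
From mathcomp Require Import ring lra.

(** Put sigma = delta * dW, so that lambda = alpha * sigma, and let the time t
    correspond to the length r = t^(1/sigma). Write |f(x) - f(y)|^p as the
    energy of the pair (x, y), and S for the supremum over r of the
    Korevaar-Schoen energies of f.

    The sub-Gaussian bounds hold almost everywhere for each time; as the kernel
    is continuous and balls have positive measure, they hold at every pair of
    points up to an arbitrarily small change of the distance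
    ([heat_kernel_pointwise_bounds]). Integrating them against the density of
    the subordinator gives, for the subordinated kernel K at time t = r^sigma,
    the upper bounds K <= C r^(-dH) and K <= C r^sigma d(x,y)^(-dH-sigma), and
    the lower bound K >= c r^(-dH) when d(x,y) < r
    ([subordinated_kernel_bounds]). Nothing but the Laplace transform of the
    density is known, so each bound is obtained by dominating a function of the
    time variable by combinations of exponentials whose integrals are explicit
    ([density_decay_profile_ge], [density_decay_profile_le],
    [density_negative_moment_le]).

    By the lower bound and by volume growth, the Korevaar-Schoen energy at scale
    r is at most a constant times t^(-alpha p) times the energy of f weighted by
    K at time t = r^sigma; this is [supKS_le_besov]. Conversely, cut the space
    of pairs at the distances 2^n r. By the upper bounds, the energy weighted by
    K is at most the sum over n of r^(-dH) 2^(-n (dH + sigma)) times the energy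
    of the pairs at distance less than 2^n r, and the latter is at most
    C (2^n r)^(dH + lambda p) S. The resulting series is geometric with ratio
    2^(lambda p - sigma), which is less than 1 exactly because alpha < 1/p; this
    is [besov_le_supKS].

    Finally the energy at scale r is at most C r^(-lambda p) times the p-th
    power of the L^p norm, so for f in L^p only small r can make the supremum
    infinite, and the upper limit at 0 is finite if and only if the supremum is
    ([supKS_limsupKS]). *)

Set Implicit Arguments.
Unset Strict Implicit.
Unset Printing Implicit Defensive.

Import Order.TTheory GRing.Theory Num.Theory.
Import numFieldNormedType.Exports.

Local Open Scope classical_set_scope.
Local Open Scope ring_scope.

(** * Elementary inequalities *)

Lemma powR_le_homo (R : realType) (r x y : R) : 0 <= r -> 0 <= x -> x <= y ->
  x `^ r <= y `^ r.
Proof.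
move=> r0 x0 xy; apply: (ge0_ler_powR r0) => //; rewrite nnegrE//.
exact: le_trans xy.
Qed.

(** Since x/q <= exp(x/q), raising to the power q gives (x/q)^q <= exp x. *)
Lemma powR_le_expR (R : realType) (q x : R) : 0 < q -> 0 <= x ->
  x `^ q <= q `^ q * expR x.
Proof.
move=> q0 x0.
have -> : expR x = expR (x / q) `^ q by rewrite -expRM divfK// gt_eqF.
rewrite -powRM ?expR_ge0 ?(ltW q0)//.
apply: (@powR_le_homo R q) => //; first exact: ltW.
rewrite -ler_pdivrMl// mulrC.
by rewrite (le_trans _ (expR_ge1Dx _))// lerDr.
Qed.

(** Apply [powR_le_expR] to x = c w^b with the exponent q/b. *)
Lemma powR_expRN_bounded (R : realType) (q b c : R) : 0 < q -> 0 < b -> 0 < c ->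
  exists2 C : R, 0 < C & forall w : R, 0 < w -> w `^ q * expR (- (c * w `^ b)) <= C.
Proof.
move=> q0 b0 c0; have qb0 : 0 < q / b by rewrite divr_gt0.
exists ((q / b) `^ (q / b) / c `^ (q / b)) => [|w w0].
  by rewrite divr_gt0// powR_gt0.
have := powR_le_expR qb0 (ltW (mulr_gt0 c0 (powR_gt0 b w0))).
rewrite (powRM _ (ltW c0) (powR_ge0 _ _)) -powRrM [b * _]mulrC divfK ?gt_eqF// => h.
by rewrite expRN ler_pdivrMr ?expR_gt0// mulrAC ler_pdivlMr ?powR_gt0// mulrC.
Qed.

(** The level n counts how many doublings fit below w. It selects the dyadic
    annulus in [kernel_le_dyadic] and the exponential in [powRN_le_dyadic_exp]. *)
Lemma exists_dyadic (R : realType) (w : R) : 1 <= w ->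
  exists n : nat, 2 ^+ n <= w < 2 ^+ n.+1.
Proof.
move=> w1.
have ex : exists n : nat, w < 2 ^+ n.
  have w0 : 0 <= w by exact: le_trans w1.
  exists (Num.truncn w).+1; apply: lt_le_trans (truncnS_gt w) _.
  by rewrite -natrX ler_nat ltnW// ltn_expl.
case: (ex_minnP ex) => -[|n] wn nmin.
  by move: wn; rewrite expr0 ltNge w1.
exists n; rewrite wn andbT leNgt; apply/negP => /nmin; by rewrite ltnn.
Qed.

Lemma nneseries_geometric_le (R : realType) (q : R) : 0 <= q -> q < 1 ->
  (\sum_(0 <= n <oo) (q ^+ n)%:E <= ((1 - q)^-1)%:E)%E.
Proof.
move=> q0 q1; apply: lime_le.
  by apply: is_cvg_nneseries => n _ _; rewrite lee_fin exprn_ge0.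
apply: nearW => n; rewrite sumEFin lee_fin.
have q1' : 0 < 1 - q by rewrite subr_gt0.
rewrite -[_^-1]mul1r ler_pdivlMr// big_mkord mulrC -[1 - q]opprB mulNr -subrX1.
by rewrite opprB lerBlDr lerDl exprn_ge0.
Qed.

(** Both |a| and |b| are at most their maximum m, so |a - b| <= 2 m. *)
Lemma powR_normB_le (R : realType) (p a b : R) : 0 <= p ->
  `|a - b| `^ p <= 2 `^ p * (`|a| `^ p + `|b| `^ p).
Proof.
move=> p0; set m := Num.max `|a| `|b|.
have am : `|a| <= m by rewrite le_max lexx.
have bm : `|b| <= m by rewrite le_max lexx orbT.
have m0 : 0 <= m by exact: le_trans am.
have h : `|a - b| `^ p <= (2 * m) `^ p.
  apply: powR_le_homo => //; apply: le_trans (ler_normB _ _) _; lra.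
apply: le_trans h _; rewrite powRM// ler_wpM2l ?powR_ge0//.
rewrite /m; case: (leP `|a| `|b|) => _; first by rewrite lerDr powR_ge0.
by rewrite lerDl powR_ge0.
Qed.

Lemma poweR_le_homo (R : realType) (x y : \bar R) (s : R) :
  0 <= s -> (0 <= x)%E -> (x <= y)%E -> (x `^ s <= y `^ s)%E.
Proof.
move=> s0 x0 xy; apply: gt0_ler_poweR => //; rewrite in_itv/= leey andbT//.
exact: le_trans xy.
Qed.

Lemma poweRK (R : realType) (p : R) (x : \bar R) : p != 0 -> (0 <= x)%E ->
  ((x `^ p) `^ p^-1 = x)%E.
Proof. by move=> p0 x0; rewrite -poweRrM divff// poweRe1. Qed.

Lemma poweRVK (R : realType) (p : R) (x : \bar R) : p != 0 -> (0 <= x)%E ->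
  ((x `^ p^-1) `^ p = x)%E.
Proof. by move=> p0 x0; rewrite -poweRrM mulVf// poweRe1. Qed.

Lemma powR2_lt1 (R : realType) (s : R) : s < 0 -> 2 `^ s < 1.
Proof.
move=> s0; rewrite /powR gt_eqF// -[ltRHS]expR0 ltr_expR.
by rewrite pmulr_llt0 ?ln_gt0 ?ltr1n.
Qed.

Lemma powR_inv (R : realType) (a v : R) : 0 <= v -> v^-1 `^ a = v `^ (- a).
Proof. by move=> v0; rewrite -(powR_inv1 v0) -powRrM mulN1r. Qed.

(** Equivalent to exp(-v) <= 1/(1+v), that is, to exp v >= 1 + v. *)
Lemma one_sub_expRN_ge (R : realType) (v : R) : 0 < v -> v / (1 + v) <= 1 - expR (- v).
Proof.
move=> v0; have v1 : 0 < 1 + v by rewrite addr_gt0.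
have : expR (- v) <= (1 + v)^-1.
  by rewrite expRN lef_pV2 ?posrE ?expR_gt0//; exact: expR_ge1Dx.
have -> : v / (1 + v) = 1 - (1 + v)^-1 by field; rewrite gt_eqF.
by move=> h; rewrite lerD2l lerN2.
Qed.

(** With v the ratio of the time to the time scale of a distance, this is the
    sub-Gaussian profile up to scaling: a is the on-diagonal exponent and b the
    exponent in the exponential decay. *)
Definition decay_profile (R : realType) (a b c v : R) : R :=
  v `^ (- a) * expR (- (c * v `^ (- b))).

Lemma decay_profile_ge0 (R : realType) (a b c v : R) : 0 <= decay_profile a b c v.
Proof. by rewrite mulr_ge0 ?powR_ge0 ?expR_ge0. Qed.

(** The right-hand side integrates against the density to
    1 - exp(-t l^delta) <= t l^delta, linear in t, and this is what yields the
    factor t of the off-diagonal bound. At infinity the profile is bounded; at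
    0 it decays faster than v because of the exponential. In terms of w = 1/v
    both facts are [powR_expRN_bounded], with the exponents a and a + 1. *)
Lemma decay_profile_le_one_sub_expRN (R : realType) (a b c : R) :
  0 < a -> 0 < b -> 0 < c ->
  exists2 C : R, 0 < C & forall v : R, 0 < v ->
    decay_profile a b c v <= C * (1 - expR (- v)).
Proof.
move=> a0 b0 c0.
have [C1 C10 h1] := powR_expRN_bounded a0 b0 c0.
have a10 : 0 < a + 1 by rewrite addr_gt0.
have [C2 C20 h2] := powR_expRN_bounded a10 b0 c0.
exists (C1 + C2) => [|v v0]; first by rewrite addr_gt0.
have w0 : 0 < v^-1 by rewrite invr_gt0.
apply: le_trans (ler_wpM2l _ (one_sub_expRN_ge v0)); last by rewrite ltW// addr_gt0.
rewrite /decay_profile -!(powR_inv _ (ltW v0)).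
have -> : v / (1 + v) = (1 + v^-1)^-1.
  by field; rewrite !gt_eqF// addr_gt0.
have w10 : 0 < 1 + v^-1 by rewrite addr_gt0.
rewrite ler_pdivlMr// mulrDr mulr1; apply: lerD; first exact: h1.
have := h2 _ w0; rewrite powRD ?(gt_eqF w0) ?implybT// powRr1 ?invr_ge0 ?(ltW v0)//.
by rewrite mulrAC.
Qed.

(** For l large enough the difference exp(-v) - e exp(-l v) has positive
    integral against the density, so this bounds the integral of the profile
    from below. For v <= 1/(l-1) the difference is nonpositive; beyond that
    point the profile decays only polynomially and dominates exp(-v). *)
Lemma expRN_le_decay_profile (R : realType) (a b c l : R) :
  0 < a -> 0 < b -> 0 < c -> 1 < l ->
  exists2 C : R, 0 < C & forall v : R, 0 < v ->
    expR (- v) <= C * decay_profile a b c v + expR 1 * expR (- (v * l)).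
Proof.
move=> a0 b0 c0 l1; have l10 : 0 < l - 1 by rewrite subr_gt0.
(* Here a^a bounds v^a exp(-v), and the other factor is the largest value of
   exp(c v^(-b)) for v >= 1/(l-1). *)
exists (a `^ a * expR (c * (l - 1) `^ b)) => [|v v0].
  by rewrite mulr_gt0 ?powR_gt0 ?expR_gt0.
have w0 : 0 < v^-1 by rewrite invr_gt0.
rewrite /decay_profile -(powR_inv b (ltW v0)).
have [vl|vl] := leP (v * (l - 1)) 1.
  apply: ler_wpDl; first by rewrite !mulr_ge0 ?powR_ge0 ?expR_ge0.
  rewrite -expRD ler_expR.
  move: vl; rewrite mulrBr mulr1; lra.
apply: ler_wpDr; first by rewrite mulr_ge0 ?expR_ge0.
rewrite expRN -[leLHS]mul1r ler_pdivrMr ?expR_gt0//.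
have hp : v `^ a * v `^ (- a) = 1.
  by rewrite powRN mulfV// gt_eqF// powR_gt0.
have he : 1 <= expR (c * (l - 1) `^ b) * expR (- (c * v^-1 `^ b)).
  rewrite -expRD -[leLHS]expR0 ler_expR -mulrBr mulr_ge0 ?(ltW c0)//.
  rewrite subr_ge0; apply: (powR_le_homo (ltW b0) (ltW w0)).
  rewrite -[v^-1]mul1r ler_pdivrMr// mulrC. exact: ltW.
have := powR_le_expR a0 (ltW v0).
move: (expR (c * _)) (expR (- _)) he hp => p q pq hp h.
have -> : a `^ a * p * (v `^ (- a) * q) * expR v =
  a `^ a * expR v * v `^ (- a) * (p * q) by ring.
by rewrite -[leLHS]mulr1 ler_pM// -[leLHS]hp ler_wpM2r// powR_ge0.
Qed.

(** For v < 1 choose n with 2^n <= 1/v < 2^(n+1): then v 2^n <= 1, so the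
    n-th exponential is at least 1/e while v^(-a) < 2^((n+1) a). After
    integration the n-th term becomes 2^(n a) exp(-2^(n delta)), which is
    summable. *)
Lemma powRN_le_dyadic_exp (R : realType) (a v : R) : 0 < a -> 0 < v ->
  ((v `^ (- a))%:E <= 1 + \sum_(0 <= n <oo)
    (expR 1 * 2 `^ a * (2 ^+ n) `^ a * expR (- (v * 2 ^+ n)))%:E)%E.
Proof.
move=> a0 v0.
have t0 n : (0 <= (expR 1 * 2 `^ a * (2 ^+ n) `^ a * expR (- (v * 2 ^+ n)))%:E)%E.
  by rewrite lee_fin !mulr_ge0 ?expR_ge0 ?powR_ge0.
have wa : v `^ (- a) = v^-1 `^ a by rewrite powR_inv// ltW.
have [v1|v1] := leP 1 v.
  apply: (@le_trans _ _ 1%E); last first.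
    by rewrite leeDl// nneseries_ge0.
  rewrite lee_fin powRN invf_le1 ?powR_gt0//.
  by have := powR_le_homo (ltW a0) ler01 v1; rewrite powR1.
have /exists_dyadic[n /andP[n1 n2]] : 1 <= v^-1 by rewrite invf_ge1 // ltW.
apply: le_trans _ (leeDr _ lee01).
apply: le_trans _ (nneseries_lim_ge n.+1 _) => //.
rewrite big_nat_recr//=; apply: le_trans _ (leeDr _ _); last first.
  by apply: sume_ge0 => i _; exact: t0.
rewrite lee_fin wa.
have e1 : 1 <= expR 1 * expR (- (v * 2 ^+ n)).
  rewrite -expRD -[leLHS]expR0 ler_expR subr_ge0 mulrC.
  by rewrite -ler_pdivlMr// mul1r.
have -> : expR 1 * 2 `^ a * (2 ^+ n) `^ a * expR (- (v * 2 ^+ n)) =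
  (2 `^ a * (2 ^+ n) `^ a) * (expR 1 * expR (- (v * 2 ^+ n))) by ring.
rewrite -[leLHS]mulr1 ler_pM ?powR_ge0//.
rewrite -powRM ?exprn_ge0// -exprS.
by apply: powR_le_homo; rewrite ?(ltW a0) ?invr_ge0 ?(ltW v0) ?(ltW n2).
Qed.

(** * Moments of the stable subordinator *)

(** The integral of a nonnegative function is a supremum over the simple
    functions below it, so monotonicity holds without measurability. It is used
    for integrands that contain the subordinated kernel, whose joint
    measurability is then never an issue. *)
Lemma le_ge0_integral d (T : measurableType d) (R : realType)
    (mu : {measure set T -> \bar R}) (D : set T) (f g : T -> \bar R) :
  (forall x, D x -> (0 <= f x)%E) -> (forall x, D x -> (f x <= g x)%E) ->
  (\int[mu]_(x in D) f x <= \int[mu]_(x in D) g x)%E.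
Proof.
move=> f0 fg; rewrite !ge0_integralE//; last first.
  by move=> x Dx; exact: le_trans (f0 _ Dx) (fg _ Dx).
apply: ereal_sup_le => _ [h hf <-]; exists h => // x.
apply: le_trans (hf x) _; rewrite /patch; case: ifPn => // /set_mem; exact: fg.
Qed.

Section stable_subordinator.
Context (R : realType) (delta : R) (eta : R -> R -> R).
Hypothesis delta_gt0 : 0 < delta.
Hypothesis etaP : stable_subordinator_density delta eta.

Local Notation "'Eta[' t ] f" :=
  (\int[lebesgue_measure]_(s in `]0%R, +oo[) (eta t s * f s)%:E)%E
  (at level 36, f at level 36).

Let m0y : measurable (`]0, +oo[%classic : set R).
Proof. exact: measurable_itv. Qed.

Let eta_ge0 (t s : R) : 0 < t -> s \in `]0, +oo[ -> 0 <= eta t s.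
Proof. by move=> t0; rewrite in_itv/= andbT; have [+ _ _] := etaP t0; exact. Qed.

Lemma measurable_density (t : R) : 0 < t ->
  measurable_fun (`]0, +oo[%classic : set R) (eta t).
Proof.
move=> t0; apply: open_continuous_measurable_fun; first exact: interval_open.
move=> s /set_mem; rewrite /= in_itv/= andbT => s0.
by have [_ + _] := etaP t0; exact.
Qed.

Lemma measurable_densityM (t : R) (f : R -> R) : 0 < t ->
  measurable_fun setT f ->
  measurable_fun (`]0, +oo[%classic : set R) (fun s => (eta t s * f s)%:E).
Proof.
move=> t0 mf; apply/measurable_EFinP.
apply: measurable_funM; first exact: measurable_density.
exact: measurable_funTS.
Qed.

Lemma measurable_expRN (l : R) : measurable_fun setT (fun s : R => expR (- (s * l))).
Proof.
apply: measurableT_comp => //.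
by apply: measurableT_comp => //; exact: measurable_funM.
Qed.

Lemma density_integralZ (t c : R) (f : R -> R) : 0 < t -> 0 <= c ->
  measurable_fun setT f -> (forall s : R, 0 < s -> 0 <= f s) ->
  (Eta[t] (fun s => c * f s) = c%:E * Eta[t] f)%E.
Proof.
move=> t0 c0 mf f0; rewrite -ge0_integralZl_EFin//.
- by apply: eq_integral => s _; rewrite -EFinM mulrCA.
- move=> s s0; rewrite lee_fin mulr_ge0 ?eta_ge0// f0//.
  by move: s0; rewrite /= in_itv/= andbT.
- exact: measurable_densityM.
Qed.

Lemma density_laplace (t c l : R) : 0 < t -> 0 <= c -> 0 < l ->
  (Eta[t] (fun s => c * expR (- (s * l))) = (c * expR (- (t * l `^ delta)))%:E)%E.
Proof.
move=> t0 c0 l0; rewrite (density_integralZ t0 c0 (measurable_expRN l)).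
  by have [_ _ ->] := etaP t0.
by move=> s _; exact: expR_ge0.
Qed.

Lemma density_le (t : R) (f g : R -> R) : 0 < t ->
  (forall s : R, 0 < s -> 0 <= f s) -> (forall s : R, 0 < s -> f s <= g s) ->
  (Eta[t] f <= Eta[t] g)%E.
Proof.
move=> t0 f0 fg; apply: le_ge0_integral => s s0.
  rewrite lee_fin mulr_ge0 ?eta_ge0// f0//.
  by move: s0; rewrite /= in_itv/= andbT.
rewrite lee_fin ler_wpM2l ?eta_ge0// fg//.
by move: s0; rewrite /= in_itv/= andbT.
Qed.

Lemma density_integralD (t : R) (f g : R -> R) : 0 < t ->
  measurable_fun setT f -> (forall s : R, 0 < s -> 0 <= f s) ->
  measurable_fun setT g -> (forall s : R, 0 < s -> 0 <= g s) ->
  (Eta[t] (fun s => f s + g s) = Eta[t] f + Eta[t] g)%E.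
Proof.
move=> t0 mf f0 mg g0; rewrite -ge0_integralD//.
- by apply: eq_integral => s _; rewrite -EFinD mulrDr.
- move=> s s0; rewrite lee_fin mulr_ge0 ?eta_ge0// f0//.
  by move: s0; rewrite /= in_itv/= andbT.
- exact: measurable_densityM.
- move=> s s0; rewrite lee_fin mulr_ge0 ?eta_ge0// g0//.
  by move: s0; rewrite /= in_itv/= andbT.
- exact: measurable_densityM.
Qed.

(** Let the Laplace parameter 1/(n+1) tend to 0 and use monotone convergence. *)
Lemma density_mass_le1 (t : R) : 0 < t -> (Eta[t] cst 1 <= 1)%E.
Proof.
move=> t0.
pose g (n : nat) (s : R) := (eta t s * expR (- (s * n.+1%:R^-1)))%:E.
have gl s : g n s @[n --> \oo] --> (eta t s * 1)%:E.
  apply: cvg_EFin; first exact: nearW.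
  apply: cvgM; first exact: cvg_cst.
  rewrite -[X in _ --> X]expR0; apply: continuous_cvg; first exact: continuous_expR.
  rewrite -[X in _ --> X]oppr0; apply: cvgN.
  rewrite -[X in _ --> X](mulr0 s); apply: cvgM.
    exact: cvg_cst.
  exact: (@cvg_harmonic R).
have -> : (Eta[t] cst 1 = \int[lebesgue_measure]_(s in `]0%R, +oo[)
    limn (fun n => g n s))%E.
  by apply: eq_integral => s _; rewrite (cvg_lim _ (gl s)).
rewrite monotone_convergence//; last 3 first.
- by move=> n; apply: measurable_densityM => //; exact: measurable_expRN.
- by move=> n s s0; rewrite lee_fin mulr_ge0 ?eta_ge0// expR_ge0.
- move=> s s0 n m nm; rewrite lee_fin ler_wpM2l ?eta_ge0//.
  move: s0; rewrite /= in_itv/= andbT => s0.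
  by rewrite ler_expR lerN2 ler_pM2l// lef_pV2 ?posrE// ler_nat ltnS.
have gE n : (\int[lebesgue_measure]_(s in `]0%R, +oo[) g n s =
    (expR (- (t * n.+1%:R^-1 `^ delta)))%:E)%E.
  by have [_ _ ->] := etaP t0.
apply: lime_le; last first.
  apply: nearW => n; rewrite gE lee_fin -[leRHS]expR0 ler_expR oppr_le0.
  by rewrite mulr_ge0 ?powR_ge0// ltW.
apply: ereal_nondecreasing_is_cvgn => n m nm; rewrite !gE lee_fin.
rewrite ler_expR lerN2 ler_pM2l//; apply: powR_le_homo => //.
  exact: ltW.
by rewrite lef_pV2 ?posrE// ler_nat ltnS.
Qed.

(** The mass is at most 1 and the Laplace transform is explicit, so the
    integral is at most 1 - exp(-t l^delta). *)
Lemma density_one_sub_expRN_le (t l : R) : 0 < t -> 0 < l ->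
  (Eta[t] (fun s => 1 - expR (- (s * l))) <= (t * l `^ delta)%:E)%E.
Proof.
move=> t0 l0; pose f (s : R) := 1 - expR (- (s * l)).
pose g (s : R) := 1 * expR (- (s * l)).
have f0 (s : R) : 0 < s -> 0 <= f s.
  move=> s0; rewrite subr_ge0 -[leRHS]expR0 ler_expR oppr_le0.
  by rewrite mulr_ge0// ltW.
have g0 (s : R) : 0 < s -> 0 <= g s by rewrite /g mul1r expR_ge0.
have mf : measurable_fun setT f.
  by apply: measurable_funB => //; exact: measurable_expRN.
have mg : measurable_fun setT g.
  by apply: measurable_funM => //; exact: measurable_expRN.
have : (Eta[t] f + Eta[t] g <= 1)%E.
  rewrite -density_integralD//.
  apply: le_trans (density_mass_le1 t0).
  by under eq_integral do rewrite /f /g mul1r subrK.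
rewrite density_laplace// mul1r => h.
rewrite -(leeD2rE (x := (expR (- (t * l `^ delta)))%:E))//.
apply: le_trans h _; rewrite -EFinD lee_fin -lerBlDl.
have := expR_ge1Dx (- (t * l `^ delta)); lra.
Qed.

Lemma measurable_decay_profile (a b c T : R) :
  measurable_fun setT (fun s : R => decay_profile a b c (s / T)).
Proof.
have mp q : measurable_fun setT (fun s : R => (s / T) `^ q).
  by apply: (measurableT_comp (measurable_powR q)); exact: measurable_funM.
apply: measurable_funM => //; apply: measurableT_comp => //.
by apply: measurableT_comp => //; exact: measurable_funM.
Qed.

(** The off-diagonal estimate: S is the time scale of the distance, and the
    probability that the subordinator reaches S before time t is of order
    t S^(-delta). *)
Lemma density_decay_profile_le (a b c : R) : 0 < a -> 0 < b -> 0 < c ->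
  exists2 C : R, 0 < C & forall t S : R, 0 < t -> 0 < S ->
    (Eta[t] (fun s => decay_profile a b c (s / S)) <= (C * (t * S `^ (- delta)))%:E)%E.
Proof.
move=> a0 b0 c0; have [C C0 hC] := decay_profile_le_one_sub_expRN a0 b0 c0.
exists C => // t S t0 S0; have Si0 : 0 < S^-1 by rewrite invr_gt0.
apply: (@le_trans _ _ (Eta[t] (fun s => C * (1 - expR (- (s * S^-1)))))%E).
  apply: density_le => // s s0; first exact: decay_profile_ge0.
  by apply: hC; rewrite divr_gt0.
rewrite density_integralZ ?(ltW C0)//; last 2 first.
- by apply: measurable_funB => //; exact: measurable_expRN.
- move=> s s0; rewrite subr_ge0 -[leRHS]expR0 ler_expR oppr_le0.
  by rewrite ltW// divr_gt0.
rewrite EFinM lee_pmul2l// -(powR_inv _ (ltW S0)).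
exact: density_one_sub_expRN_le.
Qed.

(** At time T^delta the subordinator is of size T with a probability bounded
    below. The value l = 3^(1/delta) in [expRN_le_decay_profile] makes the
    integral of exp(-v) - e exp(-l v) equal to exp(-1) - exp(-2) > 0. *)
Lemma density_decay_profile_ge (a b c : R) : 0 < a -> 0 < b -> 0 < c ->
  exists2 C : R, 0 < C & forall T : R, 0 < T ->
    (C%:E <= Eta[T `^ delta] (fun s => decay_profile a b c (s / T)))%E.
Proof.
move=> a0 b0 c0; pose l : R := 3 `^ delta^-1.
have ld : l `^ delta = 3 by rewrite -powRrM mulVf ?gt_eqF// powRr1.
have l1 : 1 < l.
  rewrite ltNge; apply/negP => l1.
  have := powR_le_homo (ltW delta_gt0) (powR_ge0 _ _) l1.
  by rewrite ld powR1; lra.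
have l0 : 0 < l by exact: lt_trans l1.
have [C C0 hC] := expRN_le_decay_profile a0 b0 c0 l1.
have ed : 0 < expR (- 1 : R) - expR (- 2) by rewrite subr_gt0 ltr_expR ltrN2 ltr1n.
exists ((expR (- 1) - expR (- 2)) / C) => [|T T0]; first by rewrite divr_gt0.
have t0 : 0 < T `^ delta by rewrite powR_gt0.
have Ti0 : 0 < T^-1 by rewrite invr_gt0.
have TT : T `^ delta * T^-1 `^ delta = 1.
  by rewrite -powRM ?(ltW T0) ?(ltW Ti0)// divff ?gt_eqF// powR1.
have mb := measurable_decay_profile a b c T.
have h : (Eta[T `^ delta] (fun s => 1 * expR (- (s * T^-1))) <=
   Eta[T `^ delta] (fun s => C * decay_profile a b c (s / T)
      + expR 1 * expR (- (s * (l / T)))))%E.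
  apply: density_le => // s s0.
  have := hC (s / T); rewrite divr_gt0// => /(_ isT).
  by rewrite mul1r mulrAC -mulrA.
have b_ge0 (s : R) : 0 < s -> 0 <= decay_profile a b c (s / T).
  by move=> _; exact: decay_profile_ge0.
have mCb : measurable_fun setT (fun s : R => C * decay_profile a b c (s / T)).
  exact: measurable_funM.
have Cb_ge0 (s : R) : 0 < s -> 0 <= C * decay_profile a b c (s / T).
  by move=> s0; rewrite mulr_ge0 ?(ltW C0) ?b_ge0.
have me : measurable_fun setT (fun s : R => expR 1 * expR (- (s * (l / T)))).
  by apply: measurable_funM => //; exact: measurable_expRN.
have e_ge0 (s : R) : 0 < s -> 0 <= expR 1 * expR (- (s * (l / T))).
  by move=> _; rewrite mulr_ge0 ?expR_ge0.
move: h; rewrite (density_integralD t0 mCb Cb_ge0 me e_ge0).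
rewrite (density_integralZ t0 (ltW C0) mb b_ge0).
rewrite !density_laplace ?expR_ge0 ?divr_gt0//.
rewrite powRM ?(ltW l0) ?(ltW Ti0)// ld mulrCA TT mulr1 mul1r -expRD.
have -> : 1 - 3 = - 2 :> R by lra.
rewrite -leeBlDr// -EFinB => h.
by rewrite mulrC EFinM lee_pdivrMl.
Qed.

(** The on-diagonal estimate. The mass accounts for the constant 1 in
    [powRN_le_dyadic_exp]; the n-th exponential integrates to
    exp(-2^(n delta)), which is at most a constant times 2^(-n (a + 1)). *)
Lemma density_negative_moment_le (a : R) : 0 < a ->
  exists2 C : R, 0 < C & forall T : R, 0 < T ->
    (Eta[T `^ delta] (fun s => (s / T) `^ (- a)) <= C%:E)%E.
Proof.
move=> a0; have q0 : 0 < (a + 1) / delta by rewrite divr_gt0// addr_gt0.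
pose C0 : R := expR 1 * 2 `^ a * ((a + 1) / delta) `^ ((a + 1) / delta).
have C00 : 0 <= C0 by rewrite !mulr_ge0 ?expR_ge0 ?powR_ge0.
exists (1 + C0 * 2) => [|T T0]; first by lra.
set t := T `^ delta; have t0 : 0 < t by rewrite powR_gt0.
pose u n (s : R) := expR 1 * 2 `^ a * (2 ^+ n) `^ a * expR (- (s * (2 ^+ n / T))).
have u0 n s : 0 <= u n s by rewrite !mulr_ge0 ?powR_ge0 ?expR_ge0.
have mu n : measurable_fun setT (u n).
  by apply: measurable_funM => //; exact: measurable_expRN.
have e0 n (s : R) : s \in `]0, +oo[ -> (0 <= (eta t s * u n s)%:E)%E.
  by move=> s0; rewrite lee_fin mulr_ge0 ?eta_ge0.
have uE n : (Eta[t] (u n) <= (C0 * 2^-1 ^+ n)%:E)%E.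
  rewrite density_laplace ?divr_gt0 ?mulr_ge0 ?expR_ge0 ?powR_ge0//.
  set y : R := 2 ^+ n; have y0 : 0 < y by rewrite exprn_gt0.
  have -> : t * (y / T) `^ delta = y `^ delta.
    by rewrite /t -powRM ?divr_ge0 ?(ltW T0) ?(ltW y0)// mulrCA divff ?gt_eqF// mulr1.
  rewrite lee_fin /C0 -!mulrA !ler_wpM2l ?expR_ge0 ?powR_ge0//.
  have := powR_le_expR q0 (powR_ge0 y delta).
  rewrite -powRrM [delta * _]mulrC divfK ?gt_eqF// powRD ?(gt_eqF y0) ?implybT//.
  rewrite powRr1 ?(ltW y0)// exprVn -/y => h.
  by rewrite expRN ler_pdivrMr ?expR_gt0// mulrAC ler_pdivlMr.
have h : (Eta[t] (fun s => (s / T) `^ (- a)) <=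
    \int[lebesgue_measure]_(s in `]0%R, +oo[)
      ((eta t s * 1)%:E + \sum_(0 <= n <oo) (eta t s * u n s)%:E))%E.
  apply: le_ge0_integral => s s0.
    by rewrite lee_fin mulr_ge0 ?eta_ge0 ?powR_ge0.
  move: (s0); rewrite /= in_itv/= andbT => s0'.
  under eq_eseriesr do rewrite EFinM.
  rewrite nneseriesZl; last by move=> n _; rewrite lee_fin.
  rewrite !EFinM -ge0_muleDr//; last first.
    by apply: nneseries_ge0 => n _ _; rewrite lee_fin.
  rewrite lee_wpmul2l ?lee_fin ?eta_ge0//.
  have := powRN_le_dyadic_exp a0 (divr_gt0 s0' T0).
  by under eq_eseriesr do rewrite [s / T * _]mulrAC -[s * _ / T]mulrA.
apply: le_trans h _; rewrite ge0_integralD//; last 4 first.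
- by move=> s s0; rewrite lee_fin mulr_ge0 ?eta_ge0.
- exact: measurable_densityM.
- by move=> s s0; apply: nneseries_ge0 => n _ _; exact: e0.
- apply: ge0_emeasurable_sum => // [n s s0 _|n _]; first exact: e0.
  exact: measurable_densityM.
rewrite integral_nneseries//; last by move=> n; exact: measurable_densityM.
rewrite EFinD; apply: leeD; first exact: density_mass_le1.
apply: (@le_trans _ _ (\sum_(0 <= n <oo) (C0%:E * (2^-1 ^+ n)%:E))%E).
  apply: lee_nneseries => n _; last by rewrite -EFinM.
  by move=> _; apply: integral_ge0 => s s0; exact: e0.
rewrite nneseriesZl; last by move=> n _; rewrite lee_fin exprn_ge0.
rewrite [(C0 * 2)%:E]EFinM; apply: lee_wpmul2l; first by rewrite lee_fin.
apply: le_trans (nneseries_geometric_le _ _) _; rewrite ?invf_lt1 ?ltr1n//.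
have -> : 1 - 2^-1 = 2^-1 :> R by lra.
by rewrite invrK.
Qed.

End stable_subordinator.

(** * Measurability and null sets on a proper metric space *)

Section metric_measure_geometry.
Context (d : measure_display) (R : realType) (X : metricMeasurableType d R).
Implicit Types (x y : X) (r : R).

Lemma metric_ball_open x r : open (ball x r).
Proof.
rewrite openE => y; rewrite ballEmdist/= => xy.
rewrite /interior nbhs_ballP; exists (r - mdist x y) => /=; first by rewrite subr_gt0.
move=> z; rewrite !ballEmdist/= ltrBrDl; apply: le_lt_trans.
exact: metric_triangle.
Qed.

Lemma metric_ballxx x r : 0 < r -> ball x r x.
Proof. by move=> r0; rewrite ballEmdist/= mdistxx. Qed.

Hypothesis borelX : borel_measurable_sets X.

Lemma metric_ball_measurable x r : measurable (ball x r).
Proof. by rewrite borelX; apply: sub_sigma_algebra; exact: metric_ball_open. Qed.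

Hypothesis compact_balls : relatively_compact_balls X.

(** Separability of a space with relatively compact balls, in the form needed
    for countable unions: the net F n is 1/(n+1)-dense in the ball of radius n
    around the base point. *)
Lemma finite_nets : exists2 F : nat -> set X, forall n, finite_set (F n) &
  forall x r, 0 < r -> exists n, exists2 q, F n q & mdist q x < r.
Proof.
have net n : exists F : set X, finite_set F /\
    closure (ball (point : X) n%:R) `<=` \bigcup_(q in F) ball q n.+1%:R^-1.
  have := @compact_balls point n%:R; rewrite compact_cover.
  move=> /(_ X setT (fun q => ball q n.+1%:R^-1))[||D _ hD].
  - by move=> q _; exact: metric_ball_open.
  - by move=> q _; exists q => //; apply: metric_ballxx; rewrite invr_gt0.
  - by exists [set` D]; split => //; exact: finite_fset.
have [F FP] := choice net.
exists F => [n|x r r0]; first by have [] := FP n.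
pose n := maxn (Num.truncn (mdist point x)).+1 (Num.truncn r^-1).
have [_ /(_ x)] := FP n.
case.
  apply: subset_closure; rewrite ballEmdist/=.
  by rewrite (lt_le_trans (truncnS_gt _))// ler_nat leq_maxl.
move=> q Fq; rewrite ballEmdist/= => qx; exists n, q => //.
apply: lt_le_trans qx _; rewrite -[leRHS]invrK lef_pV2 ?posrE ?invr_gt0//.
by rewrite ltW// (lt_le_trans (truncnS_gt _))// ler_nat ltnS leq_maxr.
Qed.

(** Separability makes this open set a countable union of rectangles
    B(q, e) x B(q, r - e), with q in the nets and e = 1/(m+1), so that it lies
    in the product sigma-algebra. *)
Lemma measurable_mdist_lt r :
  measurable [set z : X * X | mdist z.1 z.2 < r].
Proof.
have [F finF Fnet] := finite_nets.
have -> : [set z : X * X | mdist z.1 z.2 < r] =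
    \bigcup_m \bigcup_n \bigcup_(q in F n)
      (ball q m.+1%:R^-1 `*` ball q (r - m.+1%:R^-1)).
  apply/seteqP; split => [[x y]/= xy|[x y] [m _ [n _ [q _]]]]/=.
    have e0 : 0 < (r - mdist x y) / 2 by rewrite divr_gt0// subr_gt0.
    have [m em] : exists m : nat, m.+1%:R^-1 < (r - mdist x y) / 2.
      exists (Num.truncn ((r - mdist x y) / 2)^-1).
      by rewrite -[ltRHS]invrK ltf_pV2 ?posrE ?invr_gt0// truncnS_gt.
    have m0 : 0 < m.+1%:R^-1 :> R by rewrite invr_gt0.
    have [n [q Fq qx]] := Fnet x _ m0.
    exists m => //; exists n => //; exists q => //.
    rewrite /= !ballEmdist/=; split => //.
    move: (metric_triangle q x y) em qx; move: (_^-1) => e; lra.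
  rewrite !ballEmdist/= => -[qx qy].
  have := metric_triangle x q y; rewrite (metric_sym x q).
  by move: qx qy; move: (_^-1) => e; lra.
apply: bigcupT_measurable => m; apply: bigcupT_measurable => n.
apply: fin_bigcup_measurable => // q _.
by apply: measurableX; exact: metric_ball_measurable.
Qed.

Section finite_balls.
Variable mu : {measure set X -> \bar R}.
Hypothesis mu_ball_fin : forall x r, (mu (ball x r) < +oo)%E.

Lemma sigma_finite_balls : sigma_finite setT mu.
Proof.
exists (fun n => ball (point : X) n%:R) => [|n]; last first.
  by split=> //; exact: metric_ball_measurable.
apply/seteqP; split => // x _.
exists (Num.truncn (mdist point x)).+1 => //=.
by rewrite ballEmdist/= truncnS_gt.
Qed.

(* An alias that carries the sigma-finite structure needed for the theorems on
   product measures. *)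
Let mu' := mu : set X -> \bar R.
HB.instance Definition _ := Measure.on mu'.
HB.instance Definition _ := Measure_isSigmaFinite.Build _ _ _ mu' sigma_finite_balls.

Lemma measurable_section_integral (h : X * X -> \bar R) :
  measurable_fun setT h -> (forall z, 0 <= h z)%E ->
  measurable_fun setT (fun x => \int[mu]_y h (x, y))%E.
Proof. exact: (@measurable_fun_fubini_tonelli_F _ _ _ _ _ mu' h). Qed.

Lemma ge0_integral_swap (h : X * X -> \bar R) :
  measurable_fun setT h -> (forall z, 0 <= h z)%E ->
  (\int[mu]_x \int[mu]_y h (x, y) = \int[mu]_y \int[mu]_x h (x, y))%E.
Proof. exact: (@fubini_tonelli _ _ _ _ _ mu' mu' h). Qed.

Lemma iterated_integralZD (g h : X * X -> \bar R) (c : R) :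
  measurable_fun setT g -> (forall z, 0 <= g z)%E ->
  measurable_fun setT h -> (forall z, 0 <= h z)%E -> 0 <= c ->
  (\int[mu]_x \int[mu]_y (c%:E * (g (x, y) + h (x, y))) =
   c%:E * (\int[mu]_x \int[mu]_y g (x, y) + \int[mu]_x \int[mu]_y h (x, y)))%E.
Proof.
move=> mg g0 mh h0 c0.
have mgx x : measurable_fun setT (fun y => g (x, y)).
  exact: (measurableT_comp mg (measurable_pair1 x)).
have mhx x : measurable_fun setT (fun y => h (x, y)).
  exact: (measurableT_comp mh (measurable_pair1 x)).
have Ig := measurable_section_integral mg g0.
have Ih := measurable_section_integral mh h0.
have Ig0 x : (0 <= \int[mu]_y g (x, y))%E by apply: integral_ge0.
have Ih0 x : (0 <= \int[mu]_y h (x, y))%E by apply: integral_ge0.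
have inner x : (\int[mu]_y (c%:E * (g (x, y) + h (x, y))) =
    c%:E * (\int[mu]_y g (x, y) + \int[mu]_y h (x, y)))%E.
  rewrite ge0_integralZl_EFin//; last 2 first.
  - by move=> y _; rewrite adde_ge0.
  - exact: emeasurable_funD.
  by rewrite ge0_integralD.
under eq_integral do rewrite inner.
rewrite ge0_integralZl_EFin//; last 2 first.
- by move=> x _; rewrite adde_ge0.
- exact: emeasurable_funD.
by rewrite ge0_integralD.
Qed.

Hypothesis mu_ball_gt0 : forall x r, 0 < r -> (0 < mu (ball x r))%E.

(** A product of two balls has positive product measure. *)
Lemma ae_prod_meets_balls (P : set (X * X)) x y r : 0 < r ->
  (\forall z \ae (mu \x mu)%E, P z) ->
  exists z, [/\ ball x r z.1, ball y r z.2 & P z].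
Proof.
move=> r0 [N [mN N0 PN]]; apply: contrapT => nex.
have : (0 < (mu \x mu') (ball x r `*` ball y r))%E.
  by rewrite product_measure1E ?mule_gt0 ?mu_ball_gt0//;
     exact: metric_ball_measurable.
apply/negP; rewrite -leNgt -N0.
apply: (@le_measure _ _ _ (mu' \x mu')%E).
- by apply/mem_set; apply: measurableX; exact: metric_ball_measurable.
- exact/mem_set.
by move=> z [zx zy]; apply: PN => Pz; apply: nex; exists z.
Qed.

(** Otherwise f < M on a product of small balls around (x, y), and that product
    contains points satisfying P. *)
Lemma ae_ge_continuous (P : set (X * X)) (f : X * X -> R) x y r M : 0 < r ->
  {for (x, y), continuous f} -> (\forall z \ae (mu \x mu)%E, P z) ->
  (forall z, P z -> ball x r z.1 -> ball y r z.2 -> M <= f z) ->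
  M <= f (x, y).
Proof.
move=> r0 cf aeP Pf; rewrite leNgt; apply/negP => fM.
have : \forall z \near (x, y), f z < M by exact: (cf _ (lt_nbhsl fM)).
move=> [[A B] /= [/nbhs_ballP[e1 /= e10 h1] /nbhs_ballP[e2 /= e20 h2]] hAB].
pose s := Num.min r (Num.min e1 e2).
have s0 : 0 < s by rewrite !lt_min r0 e10.
have [sr s1 s2] : [/\ s <= r, s <= e1 & s <= e2].
  by rewrite /s !ge_min !lexx !orbT.
have [[u v] [/= ux vy h]] := ae_prod_meets_balls x y s0 aeP.
have := hAB (u, v) (conj (h1 _ (le_ball s1 ux)) (h2 _ (le_ball s2 vy))).
by rewrite /= ltNge Pf//; [exact: le_ball ux|exact: le_ball vy].
Qed.

End finite_balls.
End metric_measure_geometry.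

(** * Two-sided bounds for the subordinated kernel *)

Lemma sub_gaussian_profile_anti (R : realType) (dH dW c c' t r s : R) :
  0 <= c -> 0 <= c' -> 0 < t -> 1 <= dW -> 0 <= r -> r <= s ->
  sub_gaussian_profile dH dW c c' t s <= sub_gaussian_profile dH dW c c' t r.
Proof.
move=> c0 c'0 t0 dW1 r0 rs; rewrite /sub_gaussian_profile.
apply: ler_wpM2l; first by rewrite mulr_ge0 ?powR_ge0.
rewrite ler_expR lerN2; apply: (ler_wpM2l c'0).
apply: powR_le_homo; first by rewrite invr_ge0 subr_ge0.
  by rewrite divr_ge0 ?powR_ge0// ltW.
apply: ler_wpM2r; first by rewrite invr_ge0 ltW.
apply: powR_le_homo => //.
exact: le_trans dW1.
Qed.

(** Scaling: the time enters only through its ratio to r^dW. *)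
Lemma sub_gaussian_profileE (R : realType) (dH dW c c' t r : R) :
  0 < t -> 0 < r -> dW != 0 ->
  sub_gaussian_profile dH dW c c' t r =
  c * r `^ (- dH) * decay_profile (dH / dW) (dW - 1)^-1 c' (t / r `^ dW).
Proof.
move=> t0 r0 dW0; have rW0 : 0 < r `^ dW by rewrite powR_gt0.
rewrite /sub_gaussian_profile /decay_profile.
have -> : t `^ (- (dH / dW)) = r `^ (- dH) * (t / r `^ dW) `^ (- (dH / dW)).
  rewrite powRM ?invr_ge0 ?(ltW t0) ?(ltW rW0)// powR_inv ?(ltW rW0)// opprK.
  rewrite -powRrM [dW * _]mulrC divfK// [r `^ (- dH)]powRN mulrCA mulVf ?mulr1//.
  by rewrite gt_eqF// powR_gt0.
have -> : (r `^ dW / t) `^ (dW - 1)^-1 = (t / r `^ dW) `^ (- (dW - 1)^-1).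
  by rewrite -powR_inv ?invf_div// divr_ge0// ltW.
by rewrite !mulrA.
Qed.

Section subordinated_kernel_estimates.
Context (d : measure_display) (R : realType) (X : metricMeasurableType d R).
Variable mu : {measure set X -> \bar R}.
Variables (P : R -> (X -> R) -> X -> R) (k : R -> X -> X -> R) (dH dW : R).
Hypothesis borelX : borel_measurable_sets X.
Hypothesis mu_ball_fin : forall (x : X) r, (mu (ball x r) < +oo)%E.
Hypothesis mu_ball_gt0 : forall (x : X) r, 0 < r -> (0 < mu (ball x r))%E.
Hypothesis dH_gt0 : 0 < dH.
Hypothesis dW_ge2 : 2 <= dW.
Hypothesis kernelk : heat_kernel mu P k.
Hypothesis bounds : heat_kernel_bounds mu dH dW k.

Let dW_gt0 : 0 < dW. Proof. by apply: lt_le_trans dW_ge2. Qed.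
Let dW_ge1 : 1 <= dW. Proof. by apply: le_trans dW_ge2; rewrite ler1n. Qed.

Lemma heat_kernel_continuous_pair t x y : 0 < t ->
  {for (x, y), continuous (fun z : X * X => k t z.1 z.2)}.
Proof.
move=> t0; have ck := kernelk.1 t x y t0.
apply: (@continuous_comp _ _ _ (fun z : X * X => (t, z.1, z.2))
  (fun z : R * X * X => k z.1.1 z.1.2 z.2) (x, y)) => //.
have c1 : z.1 @[z --> (x, y)] --> x  by exact: (@cvg_fst _ _ (nbhs x) (nbhs y)).
have c2 : z.2 @[z --> (x, y)] --> y  by exact: (@cvg_snd _ _ (nbhs x) (nbhs y)).
have ct : (fun=> t) z @[z --> (x, y)] --> t by exact: cvg_cst.
exact: (cvg_pair (cvg_pair ct c1) c2).
Qed.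

(** The strict inequalities between r and d(x,y) leave room to move x and y to
    a nearby pair at which the almost sure bounds hold; this replaces the
    continuity of the profile in the distance. *)
Lemma heat_kernel_pointwise_bounds : exists c3 c4 c5 c6 : R,
  [/\ 0 < c3, 0 < c4, 0 < c5, 0 < c6 & forall t x y, 0 < t ->
    [/\ forall r, mdist x y < r ->
          sub_gaussian_profile dH dW c5 c6 t r <= k t x y,
        forall r, 0 <= r -> r < mdist x y ->
          k t x y <= sub_gaussian_profile dH dW c3 c4 t r
      & k t x y <= c3 * t `^ (- (dH / dW))]].
Proof.
have [c3 [c4 [c5 [c6 [c30 c40 c50 c60 hk]]]]] := bounds.
exists c3, c4, c5, c6; split=> // t x y t0.
have ck := @heat_kernel_continuous_pair t x y t0.
have ckN : {for (x, y), continuous (fun z : X * X => - k t z.1 z.2)}.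
  exact: cvgN ck.
have dist_near u v (e : R) : mdist x u < e -> mdist y v < e ->
    mdist u v < mdist x y + 2 * e /\ mdist x y < mdist u v + 2 * e.
  move=> xu yv; split.
  - have := metric_triangle u x v; have := metric_triangle x y v.
    rewrite (metric_sym u x); lra.
  - have := metric_triangle x u y; have := metric_triangle u v y.
    rewrite (metric_sym v y); lra.
split.
- move=> r xyr; have e0 : 0 < (r - mdist x y) / 2 by rewrite divr_gt0// subr_gt0.
  apply: (ae_ge_continuous borelX mu_ball_fin mu_ball_gt0 e0 ck (hk t t0)).
  move=> z [+ _] xz yz; apply: le_trans.
  apply: (sub_gaussian_profile_anti _ (ltW c50) (ltW c60)) => //.
    exact: mdist_ge0.
  move: xz yz; rewrite !ballEmdist/= => xz yz.
  by have [] := dist_near _ _ _ xz yz; lra.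
- move=> r r0 rxy; have e0 : 0 < (mdist x y - r) / 2 by rewrite divr_gt0// subr_gt0.
  rewrite -lerN2.
  apply: (ae_ge_continuous borelX mu_ball_fin mu_ball_gt0 e0 ckN (hk t t0)).
  move=> z [_ hz] xz yz; rewrite lerN2; apply: le_trans hz _.
  apply: (sub_gaussian_profile_anti _ (ltW c30) (ltW c40)) => //.
  move: xz yz; rewrite !ballEmdist/= => xz yz.
  by have [] := dist_near _ _ _ xz yz; lra.
- rewrite -lerN2.
  apply: (ae_ge_continuous borelX mu_ball_fin mu_ball_gt0 ltr01 ckN (hk t t0)).
  move=> z [_ hz] _ _; rewrite lerN2; apply: le_trans hz _.
  rewrite /sub_gaussian_profile -[leRHS]mulr1 ler_wpM2l//.
    by rewrite mulr_ge0 ?powR_ge0// ltW.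
  rewrite -[leRHS]expR0 ler_expR oppr_le0 mulr_ge0 ?powR_ge0//.
  exact: ltW.
Qed.

Variables (delta : R) (eta : R -> R -> R).
Hypothesis delta_gt0 : 0 < delta.
Hypothesis etaP : stable_subordinator_density delta eta.

(** With T = r^dW, the time r^(delta dW) is T^delta and T^(-dH/dW) = r^(-dH).
    The off-diagonal bound uses the kernel bound at half the distance, whence
    the factor 2^(dH + delta dW). *)
Lemma subordinated_kernel_bounds : exists c C : R, [/\ 0 < c, 0 < C &
  forall (r : R) (x y : X), 0 < r ->
    let Kr := subordinated_kernel eta k (r `^ (delta * dW)) x y in
    [/\ (0 <= Kr)%E,
        mdist x y < r -> ((c * r `^ (- dH))%:E <= Kr)%E,
        (Kr <= (C * r `^ (- dH))%:E)%E
      & 0 < mdist x y -> (Kr <= (C * (r `^ (delta * dW) *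
          mdist x y `^ (- (dH + delta * dW))))%:E)%E]].
Proof.
have [c3 [c4 [c5 [c6 [c30 c40 c50 c60 hk]]]]] := heat_kernel_pointwise_bounds.
have a0 : 0 < dH / dW by rewrite divr_gt0.
have b0 : 0 < (dW - 1)^-1 by rewrite invr_gt0; move: dW_ge2; lra.
have [Cl Cl0 lower] := density_decay_profile_ge delta_gt0 etaP a0 b0 c60.
have [Cn Cn0 near_upper] := density_negative_moment_le delta_gt0 etaP a0.
have [Cf Cf0 far_upper] := density_decay_profile_le delta_gt0 etaP a0 b0 c40.
pose q := dH + delta * dW.
have C1 : 0 < c3 * Cn by rewrite mulr_gt0.
have C2 : 0 < c3 * Cf * 2 `^ q by rewrite !mulr_gt0// powR_gt0.
exists (c5 * Cl), (c3 * Cn + c3 * Cf * 2 `^ q).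
split; rewrite ?mulr_gt0 ?addr_gt0// => r x y r0 /=.
have dW0 : dW != 0 by rewrite gt_eqF.
have k0 s : 0 < s -> 0 <= k s x y.
  move=> s0; have [low _ _] := hk s x y s0.
  apply: le_trans (low (mdist x y + 1) _); last by rewrite ltrDl.
  by rewrite !mulr_ge0 ?powR_ge0 ?expR_ge0// ltW.
set T := r `^ dW; have T0 : 0 < T by rewrite powR_gt0.
have tE : r `^ (delta * dW) = T `^ delta by rewrite /T -powRrM mulrC.
have t0 : 0 < T `^ delta by rewrite powR_gt0.
have rT : T `^ (- (dH / dW)) = r `^ (- dH).
  by rewrite /T -powRrM mulrN mulrC divfK.
rewrite tE /subordinated_kernel; split.
- apply: integral_ge0 => s; rewrite /= in_itv/= andbT => s0.
  rewrite lee_fin mulr_ge0 ?k0//.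
  by have [+ _ _] := etaP t0; exact.
- move=> xyr; apply: (@le_trans _ _ (\int[lebesgue_measure]_(s in `]0%R, +oo[)
    (eta (T `^ delta) s * (c5 * r `^ (- dH) *
       decay_profile (dH / dW) (dW - 1)^-1 c6 (s / T)))%:E)%E).
    rewrite (density_integralZ etaP)//; last 3 first.
    + by rewrite mulr_ge0 ?powR_ge0// ltW.
    + exact: measurable_decay_profile.
    + by move=> s _; exact: decay_profile_ge0.
    rewrite mulrAC EFinM lee_wpmul2l ?lower//.
    by rewrite lee_fin mulr_ge0 ?powR_ge0// ltW.
  apply: (density_le etaP) => // s s0.
    by rewrite mulr_ge0 ?decay_profile_ge0 ?mulr_ge0 ?powR_ge0// ltW.
  by have [low _ _] := hk s x y s0; rewrite -sub_gaussian_profileE// low.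
- apply: (@le_trans _ _ (\int[lebesgue_measure]_(s in `]0%R, +oo[)
    (eta (T `^ delta) s * (c3 * r `^ (- dH) * (s / T) `^ (- (dH / dW))))%:E)%E).
    apply: (density_le etaP) => // s s0.
    have [_ _ upp] := hk s x y s0; apply: le_trans upp _.
    rewrite -rT -mulrA -powRM ?(ltW T0) ?divr_ge0 ?(ltW s0) ?(ltW T0)//.
    by rewrite mulrCA divff ?mulr1// gt_eqF.
  rewrite (density_integralZ etaP)//; last 3 first.
  + by rewrite mulr_ge0 ?powR_ge0// ltW.
  + apply: (measurableT_comp (measurable_powR _)); exact: measurable_funM.
  + by move=> s _; exact: powR_ge0.
  apply: (@le_trans _ _ ((c3 * r `^ (- dH))%:E * Cn%:E)%E).
    rewrite lee_wpmul2l ?near_upper//.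
    by rewrite lee_fin mulr_ge0 ?powR_ge0// ltW.
  by rewrite -EFinM lee_fin mulrAC ler_wpM2r ?powR_ge0// lerDl ltW.
- set D := mdist x y => D0; have D20 : 0 < D / 2 by rewrite divr_gt0.
  apply: (@le_trans _ _ (\int[lebesgue_measure]_(s in `]0%R, +oo[)
    (eta (T `^ delta) s * (c3 * (D / 2) `^ (- dH) *
       decay_profile (dH / dW) (dW - 1)^-1 c4 (s / (D / 2) `^ dW)))%:E)%E).
    apply: (density_le etaP) => // s s0.
    have [_ upp _] := hk s x y s0; rewrite -sub_gaussian_profileE//.
    by apply: upp; [exact: ltW|rewrite -/D; lra].
  rewrite (density_integralZ etaP)//; last 3 first.
  + by rewrite mulr_ge0 ?powR_ge0// ltW.
  + exact: measurable_decay_profile.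
  + by move=> s _; exact: decay_profile_ge0.
  apply: (@le_trans _ _ ((c3 * (D / 2) `^ (- dH))%:E *
      (Cf * (T `^ delta * ((D / 2) `^ dW) `^ (- delta)))%:E)%E).
    rewrite lee_wpmul2l ?far_upper ?powR_gt0//.
    by rewrite lee_fin mulr_ge0 ?powR_ge0// ltW.
  rewrite -EFinM lee_fin -powRrM mulrN [dW * _]mulrC.
  have -> : c3 * (D / 2) `^ (- dH) *
      (Cf * (T `^ delta * (D / 2) `^ (- (delta * dW)))) =
      c3 * Cf * T `^ delta * ((D / 2) `^ (- dH) * (D / 2) `^ (- (delta * dW))).
    by ring.
  rewrite -powRD ?(gt_eqF D20) ?implybT// -opprD -/q.
  rewrite powRM ?(ltW D0) ?invr_ge0// powR_inv// opprK.
  have -> : c3 * Cf * T `^ delta * (D `^ (- q) * 2 `^ q) =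
    c3 * Cf * 2 `^ q * (T `^ delta * D `^ (- q)) by ring.
  by rewrite ler_wpM2r ?mulr_ge0 ?powR_ge0// lerDr ltW.
Qed.

End subordinated_kernel_estimates.

(** * Comparison of the energies *)

Section korevaar_schoen_and_kernel_energies.
Context (d : measure_display) (R : realType) (X : metricMeasurableType d R).
Variable mu : {measure set X -> \bar R}.
Hypothesis borelX : borel_measurable_sets X.
Hypothesis compact_balls : relatively_compact_balls X.
Variables (dH c1 c2 : R).
Hypotheses (dH_gt0 : 0 < dH) (c1_gt0 : 0 < c1) (c2_gt0 : 0 < c2).
Hypothesis mu_ball : forall (x : X) (r : R), 0 <= r ->
  ((c1 * r `^ dH)%R%:E <= mu (ball x r))%E /\
  (mu (ball x r) <= (c2 * r `^ dH)%R%:E)%E.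
Variable p : R.
Hypothesis p_ge1 : 1 <= p.

Let p_gt0 : 0 < p. Proof. exact: lt_le_trans p_ge1. Qed.
Let p_neq0 : p != 0. Proof. by rewrite gt_eqF. Qed.

Lemma ahlfors_ball_fin (x : X) (r : R) : (mu (ball x r) < +oo)%E.
Proof.
have [r0|r0] := leP 0 r; first exact: le_lt_trans (mu_ball x r0).2 (ltry _).
suff -> : ball x r = set0 by rewrite measure0 ltry.
rewrite ballEmdist -subset0 => y /= /lt_trans /(_ r0).
by rewrite ltNge mdist_ge0.
Qed.

Lemma ahlfors_ball_gt0 (x : X) (r : R) : 0 < r -> (0 < mu (ball x r))%E.
Proof.
move=> r0; apply: lt_le_trans (mu_ball x (ltW r0)).1.
by rewrite lte_fin mulr_gt0 ?powR_gt0.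
Qed.

Lemma fine_mu_ball (x : X) (r : R) : 0 < r ->
  c1 * r `^ dH <= fine (mu (ball x r)) <= c2 * r `^ dH.
Proof.
move=> r0; have [h1 h2] := mu_ball x (ltW r0).
have fin : mu (ball x r) \is a fin_num.
  by rewrite ge0_fin_numE ?ahlfors_ball_fin.
by rewrite -!lee_fin fineK// h1.
Qed.

(** The indicator makes the domain of integration independent of x, as the
    theorem on iterated integrals requires. *)
Definition pair_energy (f : X -> R) (r : R) (z : X * X) : \bar R :=
  (`|f z.1 - f z.2| `^ p * \1_[set z : X * X | mdist z.1 z.2 < r] z)%:E.

Definition ball_energy (f : X -> R) (r : R) : \bar R :=
  (\int[mu]_x \int[mu]_y pair_energy f r (x, y))%E.

Lemma pair_energyE f r x y :
  pair_energy f r (x, y) = (`|f x - f y| `^ p * ((mdist x y < r)%R)%:R)%:E.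
Proof.
rewrite /pair_energy/= indicE; congr ((_ * (nat_of_bool _)%:R)%:E).
by apply/idP/idP => [/set_mem//|xy]; exact/mem_set.
Qed.

Lemma pair_energy_ge0 f r z : (0 <= pair_energy f r z)%E.
Proof. by rewrite lee_fin mulr_ge0 ?powR_ge0. Qed.

Lemma measurable_pair_energy f r : measurable_fun setT f ->
  measurable_fun setT (pair_energy f r).
Proof.
move=> mf; apply/measurable_EFinP; apply: measurable_funM.
  apply: (measurableT_comp (measurable_powR p)).
  apply: measurableT_comp => //; apply: measurable_funB.
    exact: measurableT_comp.
  exact: measurableT_comp.
by apply: measurable_indic; exact: measurable_mdist_lt.
Qed.

Lemma measurable_pair_energy_section f r x : measurable_fun setT f ->
  measurable_fun setT (fun y => pair_energy f r (x, y)).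
Proof.
move=> mf; apply: measurableT_comp; first exact: measurable_pair_energy.
exact: measurable_pair1.
Qed.

Lemma measurable_pair_energy_integral f r : measurable_fun setT f ->
  measurable_fun setT (fun x => \int[mu]_y pair_energy f r (x, y))%E.
Proof.
move=> mf; apply: (measurable_section_integral borelX ahlfors_ball_fin).
  exact: measurable_pair_energy.
exact: pair_energy_ge0.
Qed.

Lemma ball_energyZ f r c : measurable_fun setT f -> 0 <= c ->
  (\int[mu]_x \int[mu]_y (c%:E * pair_energy f r (x, y)) =
   c%:E * ball_energy f r)%E.
Proof.
move=> mf c0; rewrite /ball_energy -ge0_integralZl_EFin//.
- apply: eq_integral => x _; rewrite ge0_integralZl_EFin//.
  + by move=> y _; exact: pair_energy_ge0.
  + exact: measurable_pair_energy_section.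
- by move=> x _; apply: integral_ge0 => y _; exact: pair_energy_ge0.
- exact: measurable_pair_energy_integral.
Qed.

Lemma korevaar_schoen_energy_ge0 lambda f r :
  (0 <= korevaar_schoen_energy mu lambda p f r)%E.
Proof.
apply: integral_ge0 => x _; apply: integral_ge0 => y _.
by rewrite lee_fin divr_ge0 ?powR_ge0// mulr_ge0 ?powR_ge0// fine_ge0.
Qed.

Lemma sup_korevaar_schoen_energy_ge0 lambda f :
  (0 <= ereal_sup [set korevaar_schoen_energy mu lambda p f r
                     | r in [set r : R | (0 < r)%R]])%E.
Proof.
apply: le_ereal_sup_tmp; exists (korevaar_schoen_energy mu lambda p f 1).
  by exists 1 => //=.
exact: korevaar_schoen_energy_ge0.
Qed.

Lemma korevaar_schoen_energyE lambda f r :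
  korevaar_schoen_energy mu lambda p f r =
  (\int[mu]_x \int[mu]_y
    ((r `^ (lambda * p) * fine (mu (ball x r)))^-1%:E * pair_energy f r (x, y)))%E.
Proof.
apply: eq_integral => x _; rewrite integral_mkcond; apply: eq_integral => y _.
rewrite /patch pair_energyE ballEmdist.
case: ifP => [/set_mem/= ->|/negP xy]; first by rewrite mulr1 -EFinM mulrC.
case: ltP => [yr|_]; first by exfalso; apply: xy; exact/mem_set.
by rewrite mulr0 mule0.
Qed.

Lemma korevaar_schoen_energy_le lambda f r : measurable_fun setT f -> 0 < r ->
  (korevaar_schoen_energy mu lambda p f r <=
   (r `^ (lambda * p) * (c1 * r `^ dH))^-1%:E * ball_energy f r)%E.
Proof.
move=> mf r0; have q0 : 0 < r `^ (lambda * p) by rewrite powR_gt0.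
have m0 : 0 < c1 * r `^ dH by rewrite mulr_gt0 ?powR_gt0.
have k0 : 0 <= (r `^ (lambda * p) * (c1 * r `^ dH))^-1.
  by rewrite invr_ge0; exact/ltW/mulr_gt0.
rewrite -(ball_energyZ _ mf k0).
rewrite korevaar_schoen_energyE; apply: le_ge0_integral => x _.
  apply: integral_ge0 => y _; rewrite mule_ge0 ?pair_energy_ge0// lee_fin.
  by rewrite invr_ge0 mulr_ge0 ?fine_ge0// ltW.
have /andP[h _] := fine_mu_ball x r0.
apply: le_ge0_integral => y _.
  rewrite mule_ge0 ?pair_energy_ge0// lee_fin.
  by rewrite invr_ge0 mulr_ge0 ?fine_ge0// ltW.
have m'0 := lt_le_trans m0 h.
apply: lee_wpmul2r; first exact: pair_energy_ge0.
by rewrite lee_fin lef_pV2 ?posrE ?(mulr_gt0 q0)// ler_pM2l.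
Qed.

Lemma ball_energy_le lambda f r : measurable_fun setT f -> 0 < r ->
  (ball_energy f r <= (r `^ (lambda * p) * (c2 * r `^ dH))%:E *
    korevaar_schoen_energy mu lambda p f r)%E.
Proof.
move=> mf r0; have q0 : 0 < r `^ (lambda * p) by rewrite powR_gt0.
have m0 : 0 < c2 * r `^ dH by rewrite mulr_gt0 ?powR_gt0.
have k0 : 0 <= (r `^ (lambda * p) * (c2 * r `^ dH))^-1.
  by rewrite invr_ge0; exact/ltW/mulr_gt0.
rewrite -(lee_pdivrMl _ _ (mulr_gt0 q0 m0)).
rewrite -(ball_energyZ _ mf k0).
rewrite korevaar_schoen_energyE; apply: le_ge0_integral => x _.
  by apply: integral_ge0 => y _; rewrite mule_ge0 ?pair_energy_ge0 ?lee_fin.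
have /andP[h1 h2] := fine_mu_ball x r0.
have m10 : 0 < c1 * r `^ dH by rewrite mulr_gt0 ?powR_gt0.
apply: le_ge0_integral => y _.
  by rewrite mule_ge0 ?pair_energy_ge0 ?lee_fin.
have m'0 := lt_le_trans m10 h1.
apply: lee_wpmul2r; first exact: pair_energy_ge0.
by rewrite lee_fin lef_pV2 ?posrE ?(mulr_gt0 q0)// ler_pM2l.
Qed.

(** The energy of a pair is at most 2^p (|f x|^p + |f y|^p). Integrating the
    first term in y, or the second one in x after exchanging the order of
    integration, produces the measure of a ball. *)
Lemma ball_energy_le_Lp f r : measurable_fun setT f -> 0 < r ->
  (ball_energy f r <=
   (2 `^ p * (2 * (c2 * r `^ dH)))%:E * \int[mu]_x (`|f x| `^ p)%:E)%E.
Proof.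
move=> mf r0.
have step (I I' J : \bar R) (a b : R) : (0 <= I)%E -> I' = I -> 0 <= a ->
    (I <= b%:E * J)%E -> (a%:E * (I + I') <= (a * (2 * b))%:E * J)%E.
  move=> I0 -> a0 IJ; rewrite EFinM -muleA; apply: lee_wpmul2l; first by rewrite lee_fin.
  apply: le_trans (leeD IJ IJ) _.
  by rewrite -mule2n -mule_natl EFinM muleA.
have mfp : measurable_fun setT (fun x => (`|f x| `^ p)%:E).
  apply/measurable_EFinP; apply: (measurableT_comp (measurable_powR p)).
  exact: measurableT_comp.
have fp0 x : (0 <= (`|f x| `^ p)%:E)%E by rewrite lee_fin powR_ge0.
pose D := [set z : X * X | mdist z.1 z.2 < r].
have mD : measurable D by exact: measurable_mdist_lt.
pose g (z : X * X) : \bar R := ((`|f z.1| `^ p)%:E * (\1_D z)%:E)%E.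
pose h (z : X * X) : \bar R := ((`|f z.2| `^ p)%:E * (\1_D z)%:E)%E.
have g0 z : (0 <= g z)%E by rewrite mule_ge0 ?lee_fin ?powR_ge0.
have h0 z : (0 <= h z)%E by rewrite mule_ge0 ?lee_fin ?powR_ge0.
have mI : measurable_fun setT (fun z : X * X => (\1_D z)%:E : \bar R).
  by apply/measurable_EFinP; exact: measurable_indic.
have mg : measurable_fun setT g.
  apply: emeasurable_funM => //.
  exact: (measurableT_comp mfp measurable_fst).
have mh : measurable_fun setT h.
  apply: emeasurable_funM => //.
  exact: (measurableT_comp mfp measurable_snd).
have gh x y : g (x, y) = h (y, x).
  by rewrite /g /h /= !indicE; congr (_ * (nat_of_bool _)%:R%:E)%E;
     apply/idP/idP => /set_mem xy; apply/mem_set; move: xy; rewrite /D/= metric_sym.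
have gE : (\int[mu]_x \int[mu]_y g (x, y) <=
    (c2 * r `^ dH)%:E * \int[mu]_x (`|f x| `^ p)%:E)%E.
  rewrite -ge0_integralZl_EFin//; last by rewrite mulr_ge0 ?powR_ge0// ltW.
  apply: le_ge0_integral => x _; first by apply: integral_ge0.
  rewrite [leRHS]muleC.
  have -> : (\int[mu]_y g (x, y) = (`|f x| `^ p)%:E * mu (ball x r))%E.
    rewrite -integral_cst; last exact: metric_ball_measurable.
    rewrite [RHS]integral_mkcond; apply: eq_integral => y _.
    rewrite /g /patch/= indicE ballEmdist.
    have -> : ((x, y) \in D) = (y \in [set y | mdist x y < r]).
      by apply/idP/idP => /set_mem xy; exact/mem_set.
    by case: ifP => _; rewrite ?mule1 ?mule0.
  by rewrite lee_wpmul2l// (mu_ball x (ltW r0)).2.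
have hE : (\int[mu]_x \int[mu]_y h (x, y) = \int[mu]_x \int[mu]_y g (x, y))%E.
  transitivity (\int[mu]_y \int[mu]_x h (x, y))%E.
    exact: (ge0_integral_swap borelX ahlfors_ball_fin mh h0).
  by apply: eq_integral => x _; apply: eq_integral => y _; rewrite gh.
have jgh z : (pair_energy f r z <= (2 `^ p)%:E * (g z + h z))%E.
  change ((`|f z.1 - f z.2| `^ p * \1_D z)%:E <= (2 `^ p *
    (`|f z.1| `^ p * \1_D z + `|f z.2| `^ p * \1_D z))%:E)%E.
  rewrite lee_fin -mulrDl mulrA; apply: ler_wpM2r; first by rewrite indicE.
  by apply: powR_normB_le; exact: ltW.
apply: (@le_trans _ _ (\int[mu]_x \int[mu]_y ((2 `^ p)%:E * (g (x, y) + h (x, y))))%E).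
  apply: le_ge0_integral => x _.
    by apply: integral_ge0 => y _; exact: pair_energy_ge0.
  apply: le_ge0_integral => y _; [exact: pair_energy_ge0|exact: jgh].
rewrite (iterated_integralZD borelX ahlfors_ball_fin mg g0 mh h0 (powR_ge0 _ _)).
apply: step hE _ gE; last exact: powR_ge0.
by apply: integral_ge0 => x _; exact: integral_ge0.
Qed.

(** Hence only small scales matter for the finiteness of the supremum. *)
Lemma korevaar_schoen_energy_le_Lp lambda f r : measurable_fun setT f -> 0 < r ->
  (korevaar_schoen_energy mu lambda p f r <=
   (r `^ (- (lambda * p)) * (2 `^ p * (2 * (c2 / c1))))%:E *
     \int[mu]_x (`|f x| `^ p)%:E)%E.
Proof.
move=> mf r0; apply: le_trans (korevaar_schoen_energy_le lambda mf r0) _.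
have rH0 : 0 < r `^ dH by rewrite powR_gt0.
have rl0 : 0 < r `^ (lambda * p) by rewrite powR_gt0.
have k0 : (0 <= ((r `^ (lambda * p) * (c1 * r `^ dH))^-1)%:E)%E.
  by rewrite lee_fin invr_ge0; exact/ltW/mulr_gt0/mulr_gt0.
apply: le_trans (lee_wpmul2l k0 (ball_energy_le_Lp mf r0)) _.
rewrite muleA -EFinM lee_wpmul2r//.
  by apply: integral_ge0 => x _; rewrite lee_fin powR_ge0.
rewrite lee_fin powRN le_eqVlt; apply/orP; left; apply/eqP.
by field; rewrite !gt_eqF.
Qed.

Section with_kernel.
Variables (K : R -> X -> X -> \bar R) (sigma c C : R).
Hypotheses (sigma_gt0 : 0 < sigma) (c_gt0 : 0 < c) (C_gt0 : 0 < C).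
Hypothesis Kbounds : forall (r : R) (x y : X), 0 < r ->
  let Kr := K (r `^ sigma) x y in
    [/\ (0 <= Kr)%E,
        mdist x y < r -> ((c * r `^ (- dH))%:E <= Kr)%E,
        (Kr <= (C * r `^ (- dH))%:E)%E
      & 0 < mdist x y ->
          (Kr <= (C * (r `^ sigma * mdist x y `^ (- (dH + sigma))))%:E)%E].

Definition kernel_energy (f : X -> R) (t : R) : \bar R :=
  (\int[mu]_y \int[mu]_x ((`|f x - f y| `^ p)%:E * K t x y))%E.

Lemma ball_energy_le_kernel_energy f r : measurable_fun setT f -> 0 < r ->
  ((c * r `^ (- dH))%:E * ball_energy f r <= kernel_energy f (r `^ sigma))%E.
Proof.
move=> mf r0; have k0 : 0 <= c * r `^ (- dH) by rewrite mulr_ge0 ?powR_ge0// ltW.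
rewrite -(ball_energyZ _ mf k0); apply: le_ge0_integral => y _.
  by apply: integral_ge0 => x _; rewrite mule_ge0 ?pair_energy_ge0 ?lee_fin.
apply: le_ge0_integral => x _; first by rewrite mule_ge0 ?pair_energy_ge0 ?lee_fin.
have [K0 low _ _] := Kbounds x y r0.
rewrite pair_energyE distrC metric_sym; case: (ltP (mdist x y) r) => xy.
  by rewrite mulr1 muleC lee_wpmul2l ?lee_fin ?powR_ge0// low.
by rewrite mulr0 mule0 mule_ge0// lee_fin powR_ge0.
Qed.

Let q := dH + sigma.
Let Cq := C * 2 `^ q.

(** Below r the on-diagonal bound is the term n = 0; on the annulus between
    2^n r and 2^(n+1) r the off-diagonal bound is the term n + 1, at the cost of
    the factor 2^q. *)
Lemma kernel_le_dyadic r x y : 0 < r ->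
  (K (r `^ sigma) x y <= \sum_(0 <= n <oo)
     (Cq * r `^ (- dH) * (2 ^+ n) `^ (- q) * ((mdist x y < 2 ^+ n * r)%R)%:R)%:E)%E.
Proof.
move=> r0; have [K0 _ upp1 upp2] := Kbounds x y r0.
have q0 : 0 < q by rewrite addr_gt0.
set u := (X in (_ <= \sum_(0 <= n <oo) X n)%E).
have u0 n : (0 <= u n)%E.
  by rewrite lee_fin !mulr_ge0 ?powR_ge0// ltW.
have term n : (u n <= \sum_(0 <= n <oo) u n)%E.
  apply: le_trans _ (nneseries_lim_ge n.+1 _) => //.
  rewrite big_nat_recr//=; apply: le_trans _ (leeDr _ _) => //.
  by apply: sume_ge0.
have [dr|rd] := ltP (mdist x y) r.
  apply: le_trans (term 0); apply: le_trans upp1 _.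
  rewrite /u expr0 mul1r dr powR1 !mulr1 lee_fin ler_wpM2r ?powR_ge0//.
  rewrite /Cq ler_peMr ?(ltW C_gt0)//.
  by have := ler_powR (ler1n R 2) (ltW q0); rewrite powRr0.
have d0 : 0 < mdist x y by exact: lt_le_trans rd.
have w1 : 1 <= mdist x y / r by rewrite ler_pdivlMr// mul1r.
have [n /andP[n1 n2]] := exists_dyadic w1.
apply: le_trans (term n.+1); apply: le_trans (upp2 d0) _.
have n2' : mdist x y < 2 ^+ n.+1 * r by rewrite -ltr_pdivrMr.
rewrite /u n2' mulr1 lee_fin /Cq -/q.
have p2 : 0 < 2 ^+ n :> R by rewrite exprn_gt0.
have dq : mdist x y `^ (- q) <= (2 ^+ n) `^ (- q) * r `^ (- q).
  rewrite -powRM ?(ltW p2) ?(ltW r0)// !powRN lef_pV2 ?posrE ?powR_gt0 ?mulr_gt0//.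
  apply: powR_le_homo; [exact: ltW|by rewrite mulr_ge0 ?ltW|].
  by rewrite -ler_pdivlMr.
have rq : r `^ sigma * r `^ (- q) = r `^ (- dH).
  rewrite -powRD ?(gt_eqF r0) ?implybT//; congr (_ `^ _).
  by rewrite /q; ring.
have two : 2 `^ q * 2 `^ (- q) = 1 :> R.
  by rewrite powRN divff// gt_eqF// powR_gt0.
rewrite exprS powRM ?(ltW p2)//.
have -> : C * 2 `^ q * r `^ (- dH) * (2 `^ (- q) * (2 ^+ n) `^ (- q)) =
  (2 `^ q * 2 `^ (- q)) * (C * (r `^ (- dH) * (2 ^+ n) `^ (- q))) by ring.
rewrite two mul1r -rq; apply: ler_wpM2l; first exact: ltW.
rewrite -mulrA; apply: ler_wpM2l; first exact: powR_ge0.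
by rewrite mulrC.
Qed.

Let a n r := Cq * r `^ (- dH) * (2 ^+ n) `^ (- q).

Let a_ge0 n r : 0 <= a n r.
Proof.
rewrite !mulr_ge0 ?powR_ge0//; exact: ltW.
Qed.

Lemma kernel_energy_le_series f r : measurable_fun setT f -> 0 < r ->
  (kernel_energy f (r `^ sigma) <=
   \sum_(0 <= n <oo) ((a n r)%:E * ball_energy f (2 ^+ n * r)))%E.
Proof.
move=> mf r0.
pose g n (z : X * X) := ((a n r)%:E * pair_energy f (2 ^+ n * r) z)%E.
have g0 n z : (0 <= g n z)%E by rewrite mule_ge0 ?lee_fin ?a_ge0 ?pair_energy_ge0.
have mg n : measurable_fun setT (g n).
  by apply: measurable_funeM; exact: measurable_pair_energy.
have mgx n x : measurable_fun setT (fun y => g n (x, y)).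
  exact: (measurableT_comp (mg n) (measurable_pair1 x)).
have Ig n := measurable_section_integral borelX ahlfors_ball_fin (mg n) (g0 n).
have Ig0 n x : (0 <= \int[mu]_y g n (x, y))%E by apply: integral_ge0.
apply: (@le_trans _ _ (\int[mu]_y \int[mu]_x \sum_(0 <= n <oo) g n (y, x))%E).
  apply: le_ge0_integral => y _.
    apply: integral_ge0 => x _; rewrite mule_ge0 ?lee_fin ?powR_ge0//.
    by have [] := Kbounds x y r0.
  apply: le_ge0_integral => x _.
    by rewrite mule_ge0 ?lee_fin ?powR_ge0//; have [] := Kbounds x y r0.
  have fxy0 : (0 <= (`|f x - f y| `^ p)%:E)%E by rewrite lee_fin powR_ge0.
  apply: le_trans (lee_wpmul2l fxy0 (kernel_le_dyadic x y r0)) _.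
  rewrite -nneseriesZl; last first.
    by move=> n _; rewrite lee_fin mulr_ge0 ?a_ge0.
  apply: lee_nneseries => n _.
    by move=> _; rewrite mule_ge0// lee_fin mulr_ge0 ?a_ge0.
  rewrite /g pair_energyE distrC metric_sym -!EFinM lee_fin.
  by rewrite le_eqVlt; apply/orP; left; apply/eqP; rewrite /a; ring.
under eq_integral do rewrite integral_nneseries//.
rewrite integral_nneseries//.
apply: lee_nneseries => n _.
  by move=> _; apply: integral_ge0.
by rewrite -(ball_energyZ _ mf (a_ge0 n r)).
Qed.

(** Ball by ball, S controls the n-th term of [kernel_energy_le_series] by
    r^(lambda p) 2^(n (lambda p - sigma)) S. *)
Lemma kernel_energy_le_sup lambda f r : measurable_fun setT f -> 0 < r ->
  lambda * p < sigma ->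
  (kernel_energy f (r `^ sigma) <=
   (Cq * c2 / (1 - 2 `^ (lambda * p - sigma)) * r `^ (lambda * p))%:E *
   ereal_sup [set korevaar_schoen_energy mu lambda p f s | s in [set s : R | (0 < s)%R]])%E.
Proof.
move=> mf r0 lps; set S := ereal_sup _.
have S0 : (0 <= S)%E := sup_korevaar_schoen_energy_ge0 lambda f.
set z := 2 `^ (lambda * p - sigma).
have z0 : 0 <= z by exact: powR_ge0.
have z1 : z < 1 by rewrite powR2_lt1// subr_lt0.
have Cq0 : 0 <= Cq by rewrite mulr_ge0 ?powR_ge0 ?ltW.
pose B := Cq * c2 * r `^ (lambda * p).
have B0 : 0 <= B by rewrite !mulr_ge0 ?powR_ge0 ?ltW.
apply: le_trans (kernel_energy_le_series mf r0) _.
apply: (@le_trans _ _ (\sum_(0 <= n <oo) (B%:E * ((z ^+ n)%:E * S)))%E).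
  apply: lee_nneseries => n _.
    move=> _; rewrite mule_ge0 ?lee_fin ?a_ge0//.
    by apply: integral_ge0 => x _; apply: integral_ge0 => y _; exact: pair_energy_ge0.
  have p2 : 0 < 2 ^+ n :> R by rewrite exprn_gt0.
  have s0 : 0 < 2 ^+ n * r by rewrite mulr_gt0.
  have an0 : (0 <= (a n r)%:E)%E by rewrite lee_fin a_ge0.
  apply: le_trans (lee_wpmul2l an0 (ball_energy_le lambda mf s0)) _.
  rewrite !muleA -!EFinM; set u := (X in (X%:E * _ <= _)%E).
  have -> : u = B * z ^+ n.
    have rr : r `^ (- dH) * r `^ dH = 1.
      by rewrite powRN mulVf// gt_eqF// powR_gt0.
    have zn : z ^+ n = (2 ^+ n) `^ (- q) * ((2 ^+ n) `^ (lambda * p) * (2 ^+ n) `^ dH).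
      rewrite -!powRD ?(gt_eqF p2) ?implybT//.
      rewrite -powR_mulrn// /z -powRrM -[in RHS]powR_mulrn// -powRrM mulrC.
      by congr (_ `^ (_ * _)); rewrite /q; ring.
    rewrite /u /a /B zn !powRM ?(ltW p2) ?(ltW r0)//.
    rewrite -[in RHS](mulr1 (_ * r `^ _)) -rr; ring.
  apply: lee_wpmul2l; first by rewrite lee_fin mulr_ge0 ?exprn_ge0.
  by apply: ereal_sup_ubound; exists (2 ^+ n * r).
have B0' : 0 < B by rewrite !mulr_gt0 ?powR_gt0.
have z1' : 0 < 1 - z by rewrite subr_gt0.
have kE : Cq * c2 / (1 - z) * r `^ (lambda * p) = B / (1 - z) by rewrite /B; ring.
(* Scalars can be taken out of the series only when they are finite. *)
rewrite kE; move: S S0 => [s| |] // S0; last first.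
  by rewrite gt0_muley ?leey// lte_fin divr_gt0.
have Bs0 : 0 <= B * s by rewrite mulr_ge0.
under eq_eseriesr do rewrite muleCA muleC -[(B%:E * s%:E)%E]/((B * s)%:E).
rewrite nneseriesZl; last by move=> n _; rewrite lee_fin exprn_ge0.
apply: (@le_trans _ _ ((B * s)%:E * ((1 - z)^-1)%:E)%E).
  by apply: lee_wpmul2l; [rewrite lee_fin|exact: nneseries_geometric_le].
by rewrite -!EFinM lee_fin mulrAC.
Qed.

Lemma kernel_energy_ge0 f t : 0 < t -> (0 <= kernel_energy f t)%E.
Proof.
move=> t0; apply: integral_ge0 => y _; apply: integral_ge0 => x _.
rewrite mule_ge0 ?lee_fin ?powR_ge0//.
have [] := Kbounds x y (powR_gt0 sigma^-1 t0).
by rewrite -powRrM mulVf ?gt_eqF// powRr1 ?(ltW t0).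
Qed.

Variable alpha : R.
Let lambda := alpha * sigma.

Let time_scale r : (r `^ sigma) `^ (- (alpha * p)) = r `^ (- (lambda * p)).
Proof. by rewrite -powRrM mulrN /lambda; congr (_ `^ (- _)); ring. Qed.

(** Raised to the power p, the Besov seminorm becomes a supremum of energies,
    which compare linearly with the Korevaar-Schoen energies. *)
Lemma besov_termE f t : 0 < t ->
  ((t `^ (- alpha))%:E * (kernel_energy f t) `^ p^-1 =
   ((t `^ (- (alpha * p)))%:E * kernel_energy f t) `^ p^-1)%E.
Proof.
move=> t0; rewrite poweRM ?lee_fin ?powR_ge0 ?kernel_energy_ge0//.
by rewrite poweR_EFin -powRrM mulNr mulfK// gt_eqF.
Qed.

Lemma besov_seminorm_ge0 f : (0 <= besov_seminorm mu K p alpha f)%E.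
Proof.
apply: le_ereal_sup_tmp; exists ((1 `^ (- alpha))%:E * (kernel_energy f 1) `^ p^-1)%E.
  by exists 1 => //=.
by rewrite mule_ge0 ?lee_fin ?powR_ge0 ?poweR_ge0.
Qed.

(** The energy at scale r is compared with the kernel energy at time r^sigma,
    where the lower bound of the kernel covers the whole ball of radius r. *)
Lemma supKS_le_besov f : measurable_fun setT f ->
  (supKS_seminorm mu lambda p f <=
   ((c1 * c)^-1 `^ p^-1)%:E * besov_seminorm mu K p alpha f)%E.
Proof.
move=> mf; set B := besov_seminorm _ _ _ _ _.
have B0 : (0 <= B)%E := besov_seminorm_ge0 f.
have c1c : 0 < (c1 * c)^-1 by rewrite invr_gt0 mulr_gt0.
have -> : ((((c1 * c)^-1 `^ p^-1)%:E * B) = (((c1 * c)^-1)%:E * B `^ p) `^ p^-1)%E.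
  by rewrite poweRM ?lee_fin ?(ltW c1c) ?poweR_ge0// (poweRK p_neq0).
apply: poweR_le_homo; first by rewrite invr_ge0 ltW.
  exact: sup_korevaar_schoen_energy_ge0.
apply: ge_ereal_sup => _ [r /= r0 <-].
have rs0 : 0 < r `^ sigma by rewrite powR_gt0.
have rl0 : 0 < r `^ (lambda * p) by rewrite powR_gt0.
have rH0 : 0 < r `^ dH by rewrite powR_gt0.
have I0 := kernel_energy_ge0 f rs0.
have term : ((r `^ (- (lambda * p)))%:E * kernel_energy f (r `^ sigma) <= B `^ p)%E.
  rewrite -[leLHS](poweRVK p_neq0) ?mule_ge0 ?lee_fin ?powR_ge0//.
  apply: poweR_le_homo; [exact: ltW|exact: poweR_ge0|].
  rewrite -time_scale -besov_termE//.
  by apply: ereal_sup_ubound; exists (r `^ sigma).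
apply: le_trans (korevaar_schoen_energy_le lambda mf r0) _.
have cr0 : 0 < c * r `^ (- dH) by rewrite mulr_gt0 ?powR_gt0.
have := ball_energy_le_kernel_energy mf r0.
rewrite -lee_pdivlMl// => J.
have k0 : (0 <= ((r `^ (lambda * p) * (c1 * r `^ dH))^-1)%:E)%E.
  by rewrite lee_fin invr_ge0; exact/ltW/mulr_gt0/mulr_gt0.
apply: le_trans (lee_wpmul2l k0 J) _.
have c1c' : (0 <= ((c1 * c)^-1)%:E)%E by rewrite lee_fin ltW.
apply: le_trans _ (lee_wpmul2l c1c' term).
rewrite !muleA -!EFinM; apply: lee_wpmul2r => //; rewrite lee_fin le_eqVlt.
apply/orP; left; apply/eqP; rewrite !powRN; field.
by rewrite !gt_eqF.
Qed.

Hypothesis alphap : alpha * p < 1.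

Lemma besov_le_supKS : exists2 C' : R, 0 < C' & forall f, measurable_fun setT f ->
  (besov_seminorm mu K p alpha f <= C'%:E * supKS_seminorm mu lambda p f)%E.
Proof.
have lps : lambda * p < sigma.
  by rewrite /lambda mulrAC gtr_pMl.
pose z : R := 2 `^ (lambda * p - sigma).
have z1 : z < 1 by rewrite powR2_lt1// subr_lt0.
pose M := Cq * c2 / (1 - z).
have M0 : 0 < M by rewrite divr_gt0 ?subr_gt0// !mulr_gt0 ?powR_gt0.
exists (M `^ p^-1) => [|f mf]; first by rewrite powR_gt0.
rewrite /supKS_seminorm; set S := ereal_sup [set _ | _ in _].
have S0 : (0 <= S)%E := sup_korevaar_schoen_energy_ge0 lambda f.
rewrite -poweR_EFin -poweRM ?lee_fin ?(ltW M0)//.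
apply: ge_ereal_sup => _ [t /= t0 <-].
rewrite -/(kernel_energy f t) besov_termE//; apply: poweR_le_homo.
- by rewrite invr_ge0 ltW.
- by rewrite mule_ge0 ?lee_fin ?powR_ge0 ?kernel_energy_ge0.
have r0 : 0 < t `^ sigma^-1 by rewrite powR_gt0.
have tE : (t `^ sigma^-1) `^ sigma = t.
  by rewrite -powRrM mulVf ?gt_eqF// powRr1 ?(ltW t0).
have := kernel_energy_le_sup mf r0 lps; rewrite tE -/S -/z -/M => h.
have k0 : (0 <= (t `^ (- (alpha * p)))%:E)%E by rewrite lee_fin powR_ge0.
apply: le_trans (lee_wpmul2l k0 h) _.
rewrite -[in t `^ (- _)]tE time_scale muleA -EFinM mulrCA.
have rl0 : 0 < (t `^ sigma^-1) `^ (lambda * p) by rewrite powR_gt0.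
by rewrite powRN mulVf ?gt_eqF// mulr1.
Qed.

End with_kernel.

Lemma Lfun_measurable_integral f : f \in Lfun mu p%:E ->
  measurable_fun setT f /\ (\int[mu]_x (`|f x| `^ p)%:E < +oo)%E.
Proof.
move=> /andP[/set_mem/= mf /set_mem/= fin]; split => //.
move: fin; rewrite /finite_norm unlock /=.
by move/lty_poweRy; apply; rewrite invr_neq0// gt_eqF.
Qed.

(** A finite upper limit bounds the energies for r below some e, and
    [korevaar_schoen_energy_le_Lp] bounds them for r >= e. *)
Lemma limsup_energy_lty lambda f : f \in Lfun mu p%:E -> 0 <= lambda ->
  (limf_esup (korevaar_schoen_energy mu lambda p f) 0^'+%R < +oo)%E ->
  (ereal_sup [set korevaar_schoen_energy mu lambda p f r | r in [set r : R | (0 < r)%R]]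
   < +oo)%E.
Proof.
move=> /Lfun_measurable_integral[mf fin] l0.
move=> /ereal_inf_lt[_ [V V0 <-] supV].
have /nbhs_ballP[e /= e0 eV] : nbhs (0 : R) [set u | 0 < u -> V u] := V0.
set g := korevaar_schoen_energy mu lambda p f in supV *.
pose A := (`|ereal_sup (g @` V)|)%E.
pose B := ((e `^ (- (lambda * p)) * (2 `^ p * (2 * (c2 / c1))))%:E *
     \int[mu]_x (`|f x| `^ p)%:E)%E.
have k0 : 0 <= 2 `^ p * (2 * (c2 / c1)).
  by rewrite !mulr_ge0 ?powR_ge0// ?invr_ge0 ltW.
have I0 : (0 <= \int[mu]_x (`|f x| `^ p)%:E)%E.
  by apply: integral_ge0 => x _; rewrite lee_fin powR_ge0.
have B0 : (0 <= B)%E by rewrite mule_ge0// lee_fin mulr_ge0 ?powR_ge0.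
have V1 : V (e / 2).
  apply: eV; last by rewrite divr_gt0.
  rewrite /ball/= sub0r normrN gtr0_norm ?divr_gt0//; lra.
have A1 : (ereal_sup (g @` V) < +oo)%E by [].
have A0 : (0 <= ereal_sup (g @` V))%E.
  apply: le_ereal_sup_tmp; exists (g (e / 2)); first by exists (e / 2).
  exact: korevaar_schoen_energy_ge0.
apply: (@le_lt_trans _ _ (ereal_sup (g @` V) + B)%E); last first.
  rewrite lte_add_pinfty// /B -ge0_fin_numE//.
  by rewrite fin_numM// ge0_fin_numE.
apply: ge_ereal_sup => _ [r /= r0 <-]; have [re|er] := ltP r e.
  apply: le_trans _ (leeDl _ B0); apply: ereal_sup_ubound; exists r => //.
  by apply: eV => //; rewrite /ball/= sub0r normrN gtr0_norm.
apply: le_trans _ (leeDr _ A0).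
apply: le_trans (korevaar_schoen_energy_le_Lp lambda mf r0) _.
apply: lee_wpmul2r => //; rewrite lee_fin; apply: ler_wpM2r => //.
rewrite !powRN lef_pV2 ?posrE ?powR_gt0//; apply: powR_le_homo => //.
  by rewrite mulr_ge0// ltW.
exact: ltW.
Qed.

Lemma limsup_energy_le_sup lambda f :
  (limf_esup (korevaar_schoen_energy mu lambda p f) 0^'+%R <=
   ereal_sup [set korevaar_schoen_energy mu lambda p f r | r in [set r : R | (0 < r)%R]])%E.
Proof.
apply: ereal_inf_lbound; exists [set r : R | 0 < r] => //.
exact: nbhs_right_gt.
Qed.

Lemma supKS_limsupKS lambda : 0 <= lambda ->
  supKS mu lambda p = limsupKS mu lambda p.
Proof.
move=> l0; have pV : p^-1 != 0 by rewrite invr_neq0// gt_eqF.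
apply/seteqP; split => f [Lf fin]; split => //.
- apply: poweR_lty; apply: le_lt_trans (limsup_energy_le_sup lambda f) _.
  exact: lty_poweRy pV fin.
- apply: poweR_lty; apply: limsup_energy_lty => //.
  exact: lty_poweRy pV fin.
Qed.

End korevaar_schoen_and_kernel_energies.

(** * Equality of the spaces *)

Theorem theorem3p1 (d : measure_display) (R : realType)
  (X : metricMeasurableType d R) (mu : {measure set X -> \bar R})
  (F : set (X -> R)) (E : (X -> R) -> (X -> R) -> R)
  (P : R -> (X -> R) -> X -> R) (k : R -> X -> X -> R)
  (dH dW kappa delta p alpha : R) (eta : R -> R -> R) :
  locally_compact [set: X] ->
  borel_measurable_sets X ->
  radon_measure mu ->
  measure_support mu = [set: X] ->
  dirichlet_form mu F E ->
  heat_semigroup mu F E P ->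
  relatively_compact_balls X ->
  0 < dH -> ahlfors_regular mu dH ->
  regular_form mu F E -> strongly_local mu F E ->
  2 <= dW -> heat_kernel mu P k -> heat_kernel_bounds mu dH dW k ->
  0 < kappa -> kappa < dW -> critical_exponent mu dW kappa ->
  weak_bakry_emery mu dW kappa k ->
  0 < delta -> delta < 1 -> stable_subordinator_density delta eta ->
  1 <= p -> 0 < alpha -> alpha < p^-1 ->
  let K := subordinated_kernel eta k in
  let lambda := alpha * delta * dW in
  [/\ besov_class mu K p alpha = supKS mu lambda p,
      supKS mu lambda p = limsupKS mu lambda p
    & exists c C : R, [/\ 0 < c, 0 < C &
        forall f, besov_class mu K p alpha f ->
          (c%:E * supKS_seminorm mu lambda p f <= besov_seminorm mu K p alpha f)%E
          /\
          (besov_seminorm mu K p alpha f <= C%:E * supKS_seminorm mu lambda p f)%E]].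
Proof.
move=> _ borelX _ _ _ _ compact_balls dH0 [c1 [c2 [c10 c20 mu_ball]]] _ _.
move=> dW2 kernelk bounds _ _ _ _ delta0 _ etaP p1 alpha0 alphap K lambda.
have p0 : 0 < p by exact: lt_le_trans p1.
have dW0 : 0 < dW by exact: lt_le_trans dW2.
have sigma0 : 0 < delta * dW by rewrite mulr_gt0.
have lambdaE : lambda = alpha * (delta * dW) by rewrite /lambda mulrA.
have alphap1 : alpha * p < 1 by rewrite -ltr_pdivlMr// div1r.
have [c [C [c0 C0 Kbounds]]] := subordinated_kernel_bounds borelX
  (ahlfors_ball_fin mu_ball) (ahlfors_ball_gt0 c10 mu_ball) dH0 dW2 kernelk bounds
  delta0 etaP.
have supKS_le f (mf : measurable_fun setT f) := supKS_le_besov borelX compact_balls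
  c10 mu_ball p1 sigma0 c0 Kbounds alpha mf.
have [M M0 besov_le] := besov_le_supKS borelX compact_balls dH0 c10 c20 mu_ball
  p1 sigma0 C0 Kbounds alphap1.
have N0 : 0 < (c1 * c)^-1 `^ p^-1 by rewrite powR_gt0// invr_gt0 mulr_gt0.
have Lfun_meas f (Lf : f \in Lfun mu p%:E) := (Lfun_measurable_integral p1 Lf).1.
have lty_mul (x y : \bar R) (a : R) : 0 < a -> (x <= a%:E * y)%E -> (y < +oo)%E -> (x < +oo)%E.
  move=> a0 xy yoo; apply: le_lt_trans xy _; case: y yoo => [y| |]//= _.
    by rewrite -EFinM ltry.
  by rewrite gt0_muleNy ?lte_fin// ltNyr.
rewrite -lambdaE in supKS_le besov_le.
split.
- apply/seteqP; split => f [Lf fin]; split => //.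
  + exact: lty_mul N0 (supKS_le f (Lfun_meas f Lf)) fin.
  + exact: lty_mul M0 (besov_le f (Lfun_meas f Lf)) fin.
- apply: (supKS_limsupKS borelX compact_balls c10 c20 mu_ball p1).
  by rewrite lambdaE mulr_ge0 ?ltW.
- exists ((c1 * c)^-1 `^ p^-1)^-1, M; split; rewrite ?invr_gt0//.
  move=> f [/Lfun_meas mf _]; split; last exact: besov_le.
  by rewrite lee_pdivrMl//; exact: supKS_le.
Qed.
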